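(* For a function $f:\mathbb{R}_+^d\to\mathbb{R}$, the following statements are equivalent: (i) $f\in\mathcal{F}_{mi}^{c,l}(\mathbb{R}_+^d)$ and $f$ is right-continuous. (ii) For all $I\subseteq\{1,\ldots,d\}$, $I\ne\emptyset$, there exist right-continuous, $\Delta$-monotone, and grounded functions $g_{(I)},h_{(I)}:\mathbb{R}_+^{|I|}\to\mathbb{R}$, at least one of which is bounded, such that $$g_{(I)}(0)=h_{(I)}(0)=0,$$ $$F^{f_I}(y)=g_{(I)}(y)-h_{(I)}(y)\quad\text{for all }y\in\mathbb{R}_+^{|I|},$$ $$\mathrm{Var_{HK}}(F^{f_I}|_{[0,y]})=\mathrm{Var_{HK}}(g_{(I)}|_{[0,y]})+\mathrm{Var_{HK}}(h_{(I)}|_{[0,y]})<\infty\quad\text{for all }y\in\mathbb{R}_+^{|I|},$$ and $$f(x)=f(0)+\sum_{k=1}^d\ \sum_{\substack{I\subseteq\{1,\ldots,d\}\\ I=\{i_1,\ldots,i_k\}}}\big[g_{(I)}(x_{i_1},\ldots,x_{i_k})-h_{(I)}(x_{i_1},\ldots,x_{i_k})\big]$$ for all $x=(x_1,\ldots,x_d)\in\mathbb{R}_+^d$. The functions $g_{(I)}$ and $h_{(I)}$, $I\subseteq\{1,\ldots,d\}$, $I\ne\emptyset$, in (ii) are uniquely determined.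
   Context: $\mathbb{R}_+=[0,\infty)$, $d\in\mathbb{N}$. Right-continuous means right-continuous in each component. Inequalities and maxima of vectors are componentwise; $[x,y]=\prod_i[x_i,y_i]$. All notions are used analogously on $\mathbb{R}_+^{|I|}$. A signed measure is a countably additive set function on the Borel sets with value $0$ at $\emptyset$, attaining at most one of the values $\pm\infty$. Difference operators: $\Delta_\varepsilon^if(z)=f(z+\varepsilon e_i)-f(z)$; for $x\le y$, $\Delta_{x,y}[f]=\Delta^1_{y_1-x_1}\cdots\Delta^d_{y_d-x_d}f(x)$; $D_{x,y}[f]=\lim_{\delta_1\downarrow0}\lim_{\varepsilon_1\downarrow0}\cdots\lim_{\delta_d\downarrow0}\lim_{\varepsilon_d\downarrow0}\Delta_{0\vee(x-\delta),\,y+\varepsilon}[f]$, whenever this iterated limit exists and coincides for all permutations of the limits. $f$ is measure-inducing if there is a signed measure $\nu$ on $\mathbb{R}_+^d$ with $\nu([x,y])=D_{x,y}[f]$ for all $x\le y$ in $\mathbb{R}_+^d$. Classes. $\mathcal{F}_{mi}^c(\mathbb{R}_+^d)$: measure-inducing $f$ such that (1) all componentwise left- and right-hand limits exist, and for every $x\in(0,\infty)^d$ there are a permutation $(i_1,\ldots,i_d)$ and $k_j\in\{-1,1\}$ with $f(x)=\lim_{\varepsilon_1\downarrow0}\cdots\lim_{\varepsilon_d\downarrow0}f(x+\sum_jk_j\varepsilon_je_{i_j})$; (2) in each component $i$, $f$ is right-continuous at $x_i=0$ for all values of the other coordinates. Lower $I$-marginal: $f_I((x_i)_{i\in I})=\lim_{x_j\downarrow0,\,j\notin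 I}f(x_1,\ldots,x_d)$ (iterated limit, when it exists independently of the order); $f_\emptyset$ is a constant, $f_{\{1,\ldots,d\}}=f$. $\mathcal{F}_{mi}^{c,l}(\mathbb{R}_+^d)$: those $f\in\mathcal{F}_{mi}^c(\mathbb{R}_+^d)$ with $f_I\in\mathcal{F}_{mi}^c(\mathbb{R}_+^{|I|})$ for all $\emptyset\neq I\subset\{1,\ldots,d\}$. For a function $q$ of $m$ variables, $F^q(x)=q(x)-\sum_{J\subsetneq\{1,\ldots,m\}}(-1)^{m-|J|-1}q_J((x_j)_{j\in J})$. Grounded: $\lim_{x_j\downarrow0}f(x)=0$ for all $j$ and all $x_i\in\mathbb{R}_+$, $i\ne j$. $f$ is $k$-increasing if for all $k$ distinct indices $i_1,\ldots,i_k$, $\Delta^{i_1}_{\varepsilon_1}\cdots\Delta^{i_k}_{\varepsilon_k}f(x)\ge0$ for all $x$ and all $\varepsilon_1,\ldots,\varepsilon_k>0$. $f$ is $\Delta$-monotone if it is $k$-increasing for all $k$ from $1$ to its number of variables. Hardy-Krause variation (anchored at the lower corner) of $f$ on a compact cuboid $[a,b]$: $\mathrm{Var_{HK}}(f)=\sum_{\emptyset\ne I}\sup_{\mathcal{P}^I}\sum_{[x,y]\in\mathcal{P}^I}|\Delta_{x,y}[f_I]|$, the sum being over non-empty subsets $I$ of the index set and the supremum over all partitions $\mathcal{P}^I$ of $\prod_{i\in I}[a_i,b_i]$ into axis-parallel boxes formed as products of one-dimensional partitions of the $[a_i,b_i]$, with $f_I$ the lower $I$-marginal on $[a,b]$ (limit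 $x_j\downarrow a_j$, $j\notin I$). *)

(* Defs.v *)
From HB Require Import structures.
From mathcomp Require Import all_boot all_order all_algebra perm.
From mathcomp Require Import all_classical all_reals all_analysis.
Set Implicit Arguments.
Unset Strict Implicit.
Unset Printing Implicit Defensive.
Import Order.TTheory GRing.Theory Num.Theory.
Import numFieldNormedType.Exports.
Local Open Scope classical_set_scope.
Local Open Scope ring_scope.

(* A function R_+^n -> R is represented by a total function 'rV[R]_n -> R;
   every notion below only depends on its values on [orthant n].  R^|I|, for
   I : {set 'I_n}, is 'rV[R]_#|I|: coordinate j corresponds to the j-th smallest
   element [enum_val j] of I. *)
Section Vectors.
Variable R : realType.

Definition orthant (n : nat) : set 'rV[R]_n := [set x | forall i, 0 <= x 0 i].

Definition vle (n : nat) (x y : 'rV[R]_n) : Prop := forall i, x 0 i <= y 0 i.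

Definition cbox (n : nat) (x y : 'rV[R]_n) : set 'rV[R]_n :=
  [set z | vle x z /\ vle z y].

Definition unitv (n : nat) (i : 'I_n) : 'rV[R]_n := delta_mx 0 i.

Definition restr (n : nat) (I : {set 'I_n}) (x : 'rV[R]_n) : 'rV[R]_#|I| :=
  \row_(j < #|I|) x 0 (enum_val j).

(* The vector whose I-coordinates are those of y and whose other coordinates
   are given by e. *)
Definition fill (n : nat) (I : {set 'I_n}) (y : 'rV[R]_#|I|) (e : 'I_n -> R) :
    'rV[R]_n :=
  \row_(i < n) oapp (y 0) (e i) [pick j : 'I_#|I| | enum_val j == i].

End Vectors.

Section IteratedLimits.
Variable R : realType.

(* With s = [:: t1; ...; tm], [iterlim p s G e L] says that the iterated limit
     lim_{e_t1 \downarrow p_t1} ... lim_{e_tm \downarrow p_tm} G e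
   exists in R and equals L (the limit in e_tm is the innermost one).  As usual,
   an inner limit is only required to exist for values of the outer variables
   close enough to their limit points; variables not in s keep their value. *)
Fixpoint iterlim (T : eqType) (p : T -> R) (s : seq T) (G : (T -> R) -> R)
    (e : T -> R) (L : R) : Prop :=
  if s is t :: s' then
    exists phi : R -> R,
      (\forall u \near (p t)^'+, iterlim p s' G [eta e with t |-> u] (phi u)) /\
      phi u @[u --> (p t)^'+] --> L
  else G e = L.

Definition iterlim_any_order (T : eqType) (p : T -> R) (s : seq T)
    (G : (T -> R) -> R) (L : R) : Prop :=
  forall s', perm_eq s' s -> iterlim p s' G p L.

End IteratedLimits.

Section Functions.
Variables (R : realType) (n : nat).
Implicit Types (f : 'rV[R]_n -> R) (x y : 'rV[R]_n) (i : 'I_n).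

Definition rcontinuous f : Prop :=
  forall x, orthant x -> forall i,
    f (x + t *: unitv R i) @[t --> (0 : R)^'+] --> f x.

Definition pdiff i (eps : R) f : 'rV[R]_n -> R :=
  fun z => f (z + eps *: unitv R i) - f z.

(* pdiffs [:: i1; ...; ik] eps f =
     Delta^{i1}_{eps i1} ( ... (Delta^{ik}_{eps ik} f)) *)
Definition pdiffs (s : seq 'I_n) (eps : 'I_n -> R) f : 'rV[R]_n -> R :=
  foldr (fun i h => pdiff i (eps i) h) f s.

Definition Delta x y f : R :=
  pdiffs (enum 'I_n) (fun i => y 0 i - x 0 i) f x.

(* D_{x,y}[f] exists and equals L.  The variables of the iterated limit are the
   delta_i, tagged [inl i], and the eps_i, tagged [inr i]. *)
Definition is_D x y f (L : R) : Prop :=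
  iterlim_any_order (fun _ : 'I_n + 'I_n => 0) (enum {: 'I_n + 'I_n})
    (fun e => Delta (\row_i Num.max 0 (x 0 i - e (inl i)))
                    (\row_i (y 0 i + e (inr i))) f) L.

Definition borel_orthant (A : set 'rV[R]_n) : Prop :=
  <<s [set U : set 'rV[R]_n | open U] >> A /\ A `<=` @orthant R n.

(* Signed measures on R_+^n, possibly infinite-valued (unlike the library's
   charges). *)
Definition signed_measure (nu : set 'rV[R]_n -> \bar R) : Prop :=
  [/\ nu set0 = 0%E,
      ~ ((exists2 A, borel_orthant A & nu A = +oo%E) /\
         (exists2 A, borel_orthant A & nu A = -oo%E)) &
      forall F : nat -> set 'rV[R]_n,
        (forall k, borel_orthant (F k)) -> trivIset setT F ->
        (fun m => (\sum_(0 <= k < m) nu (F k))%E) @ \oo -->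
          nu (\bigcup_k F k)].

Definition measure_inducing f : Prop :=
  exists nu : set 'rV[R]_n -> \bar R, signed_measure nu /\
    forall x y, orthant x -> vle x y ->
      exists2 L : R, is_D x y f L & nu (cbox x y) = L%:E.

Definition onesided_limits f : Prop :=
  forall x, orthant x -> forall i,
    cvg (f (x + t *: unitv R i) @[t --> (0 : R)^'+]) /\
    (0 < x 0 i -> cvg (f (x - t *: unitv R i) @[t --> (0 : R)^'+])).

Definition value_is_corner_limit f : Prop :=
  forall x, (forall i, 0 < x 0 i) ->
    exists (sigma : 'S_n) (k : 'I_n -> R),
      (forall j, k j = -1 \/ k j = 1) /\
      iterlim (fun _ : 'I_n => 0) (enum 'I_n)
        (fun e => f (x + \sum_(j < n) (k j * e j) *: unitv R (sigma j)))
        (fun _ => 0) (f x).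

Definition right_continuous_at_axes f : Prop :=
  forall x i, orthant x -> x 0 i = 0 ->
    f (x + t *: unitv R i) @[t --> (0 : R)^'+] --> f x.

Definition Fmic f : Prop :=
  [/\ measure_inducing f, onesided_limits f, value_is_corner_limit f &
      right_continuous_at_axes f].

(* Lower I-marginal anchored at a: limit x_j \downarrow a_j for j \notin I, in
   any order. *)
Definition is_marginal_at (a : 'rV[R]_n) f (I : {set 'I_n}) (y : 'rV[R]_#|I|)
    (L : R) : Prop :=
  iterlim_any_order (a 0) (enum (~: I)) (fun e => f (fill y e)) L.
Arguments is_marginal_at a f I y L : clear implicits.

(* Takes the value 0 where the limit does not exist. *)
Definition marginal_at (a : 'rV[R]_n) f (I : {set 'I_n}) : 'rV[R]_#|I| -> R :=
  fun y : 'rV[R]_#|I| => xget 0 [set L | is_marginal_at a f I y L].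
Arguments marginal_at a f I : clear implicits.

Definition marginal f (I : {set 'I_n}) : 'rV[R]_#|I| -> R :=
  marginal_at 0 f I.
Arguments marginal f I : clear implicits.

Definition has_marginal f (I : {set 'I_n}) : Prop :=
  forall y : 'rV[R]_#|I|, orthant y -> exists L, is_marginal_at 0 f I y L.

Definition Ftrans f : 'rV[R]_n -> R := fun x =>
  f x - \sum_(J : {set 'I_n} | J \proper finset.setT)
          (-1) ^+ (n - #|J| - 1) * marginal f J (restr J x).

(* Well-definedness of [Ftrans f] on the orthant. *)
Definition has_Ftrans f : Prop :=
  forall J : {set 'I_n}, J \proper finset.setT -> has_marginal f J.

Definition grounded f : Prop :=
  forall x j, orthant x ->
    f (\row_i (if i == j then t else x 0 i)) @[t --> (0 : R)^'+] --> (0 : R).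

Definition k_increasing f (k : nat) : Prop :=
  forall (s : k.-tuple 'I_n), uniq s ->
  forall (eps : 'I_n -> R), (forall i, 0 < eps i) ->
  forall x, orthant x -> 0 <= pdiffs s eps f x.

Definition Delta_monotone f : Prop :=
  forall k : nat, (1 <= k <= n)%N -> k_increasing f k.

Definition bounded_on_orthant f : Prop :=
  exists M : R, forall x, orthant x -> `|f x| <= M.

(* The family of one-dimensional partitions
     a_i = t_0 < t_1 < ... < t_m = b_i  with  s i = [:: t_1; ...; t_m]
   (m = 0 if a_i = b_i) yields the boxes indexed by all the choices of one
   subinterval per coordinate. *)
Definition grid_variation (a b : 'rV[R]_n) f (s : 'I_n -> seq R) : R :=
  \sum_(k : {dffun forall i : 'I_n, 'I_(size (s i))})
    `| Delta (\row_i nth 0 (a 0 i :: s i) (k i)) (\row_i nth 0 (s i) (k i)) f |.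

Definition vitali_variation (a b : 'rV[R]_n) f : \bar R :=
  ereal_sup [set v | exists2 s : 'I_n -> seq R,
    (forall i, itv_partition (a 0 i) (b 0 i) (s i)) &
    v = (grid_variation a b f s)%:E].

End Functions.

Arguments is_marginal_at {R n} a f I y L.
Arguments marginal_at {R n} a f I _.
Arguments marginal {R n} f I _.
Arguments has_marginal {R n} f I.

Definition VarHK (R : realType) (n : nat) (f : 'rV[R]_n -> R) (a b : 'rV[R]_n) :
    \bar R :=
  (\sum_(I : {set 'I_n} | I != finset.set0)
     vitali_variation (restr I a) (restr I b) (marginal_at a f I))%E.

Definition Fmicl (R : realType) (n : nat) (f : 'rV[R]_n -> R) : Prop :=
  Fmic f /\
  forall I : {set 'I_n}, I != finset.set0 ->
    has_marginal f I /\ Fmic (marginal f I).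

(* The properties required of the families g_(I), h_(I).  The first clause says
   that f_I and F^{f_I}, which occur in the other clauses, are well defined. *)
Definition decomposition (R : realType) (d : nat) (f : 'rV[R]_d -> R)
    (g h : forall I : {set 'I_d}, 'rV[R]_#|I| -> R) : Prop :=
  (forall I : {set 'I_d}, I != finset.set0 ->
     let F := Ftrans (marginal f I) in
     [/\ has_marginal f I /\ has_Ftrans (marginal f I),
         [/\ rcontinuous (g I), Delta_monotone (g I) & grounded (g I)] /\
         [/\ rcontinuous (h I), Delta_monotone (h I) & grounded (h I)],
         bounded_on_orthant (g I) \/ bounded_on_orthant (h I),
         g I 0 = 0 /\ h I 0 = 0 &
         forall y : 'rV[R]_#|I|, orthant y ->
           [/\ F y = g I y - h I y,
               VarHK F 0 y = (VarHK (g I) 0 y + VarHK (h I) 0 y)%E &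
               (VarHK F 0 y < +oo)%E]]) /\
  forall x : 'rV[R]_d, orthant x ->
    f x = f 0 + \sum_(1 <= k < d.+1) \sum_(I : {set 'I_d} | #|I| == k)
                  (g I (restr I x) - h I (restr I x)).

(* Main.v *)
Require Import Defs.
From HB Require Import structures.
From mathcomp Require Import all_boot all_order all_algebra perm.
From mathcomp Require Import all_classical all_reals all_analysis.
From mathcomp Require Import ring lra.
Set Implicit Arguments.
Unset Strict Implicit.
Unset Printing Implicit Defensive.
Import Order.TTheory GRing.Theory Num.Theory.
Import numFieldNormedType.Exports.
Local Open Scope classical_set_scope.
Local Open Scope ring_scope.

(** For right-continuous f, marginals are obtained by setting coordinates to 0,
    and F^{f_I}(y) = Delta_{0,y} f_I. Since 0 \vee (0 - delta) = 0, the limit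
    D_{0,y} f_I reduces to Delta_{0,y} f_I, so that a signed measure nu_I
    inducing f_I satisfies nu_I([0,y]) = F^{f_I}(y), which vanishes when [0,y]
    lies in a face; hence nu_I((0,y]) = F^{f_I}(y). The Hahn decomposition of
    nu_I yields g_(I) and h_(I) as the distribution functions of its positive
    and negative parts, one of which is finite because nu_I omits one of the
    values +oo and -oo. Approximating the Hahn set by unions of dyadic cells
    shows that the variation of F^{f_I} on [0,y] is g_(I)(y) + h_(I)(y); lower
    marginals of grounded functions vanish, so that Hardy-Krause and Vitali
    variations agree. The formula for f is Moebius inversion over the subsets
    of the index set.

    Conversely, g_(I) and h_(I) induce Lebesgue-Stieltjes measures (Caratheodory
    extension), whose difference is a signed measure by the boundedness
    assumption; the iterated limits D_{x,y} exist in every order because the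
    increments of g_(I) and h_(I) over boxes are monotone in the box.

    Uniqueness holds since g - h = F and g + h is the variation of F.

    Linear identities between increments are verified on product functions
    x |-> prod_i phi_i(x_i) only, see [finlin_eq]. *)

(** * Difference operators *)

(** Two obstacles shape the development. First, functions and measures are total objects on R^n
    although only the orthant matters. Composition with the clamp [pos] bridges the gap: [f \o pos]
    is right-continuous everywhere, its increment over a box is that of [f] over the clamped box,
    and the clamp of the lower corner is exactly the maximum with 0 in [is_D]. A measure induced by
    such a function gives no mass to the faces of the orthant, which fits D_{0,y} being Delta_{0,y};
    half-open boxes with negative lower corners can therefore stand for closed boxes touching a
    face. Second, the index sets I have different sizes, so the analysis of one function q = f_I is
    done in an arbitrary positive dimension n, and the family over I is assembled only at the end.
    There the full index set needs a transport, since R^|{1,...,d}| and R^d are different types, and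
    d = 0 needs an argument of its own, since no non-empty I carries information about f. *)

Section FiniteFunctionals.
Variables (R : realType) (n : nat).
Implicit Types (f : 'rV[R]_n -> R) (x y : 'rV[R]_n) (phi : 'I_n -> R -> R).

Definition prodfun phi : 'rV[R]_n -> R := fun z => \prod_i phi i (z 0 i).

Definition finlin (L : ('rV[R]_n -> R) -> R) :=
  exists s : seq (R * 'rV[R]_n), forall f, L f = \sum_(c <- s) c.1 * f c.2.

Lemma finlin_eval z : finlin (fun f => f z).
Proof. by exists [:: (1, z)] => f; rewrite big_seq1 mul1r. Qed.

Lemma finlinD L L' : finlin L -> finlin L' -> finlin (fun f => L f + L' f).
Proof.
by move=> [s Ls] [s' Ls']; exists (s ++ s') => f; rewrite big_cat Ls Ls'.
Qed.

Lemma finlinZ a L : finlin L -> finlin (fun f => a * L f).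
Proof.
move=> [s Ls]; exists [seq (a * c.1, c.2) | c <- s] => f.
by rewrite big_map Ls mulr_sumr; apply: eq_bigr => c _; rewrite mulrA.
Qed.

Lemma finlinB L L' : finlin L -> finlin L' -> finlin (fun f => L f - L' f).
Proof.
move=> fL /(finlinZ (-1)) fL'; have [s Ls] := finlinD fL fL'.
by exists s => f; rewrite -Ls mulN1r.
Qed.

Lemma finlin_sum (J : Type) (r : seq J) (P : pred J)
    (L : J -> ('rV[R]_n -> R) -> R) :
  (forall j, finlin (L j)) -> finlin (fun f => \sum_(j <- r | P j) L j f).
Proof.
move=> fL; elim: r => [|j r [s sE]].
  by exists [::] => f; rewrite !big_nil.
have [s' sE'] := fL j; exists (if P j then s' ++ s else s) => f.
by rewrite big_cons; case: ifP => _; rewrite ?big_cat sE ?sE'.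
Qed.

(* A function restricted to the finite set of points involved is a linear
   combination of indicators of points, which are product functions. *)
Lemma finlin_eq L L' : finlin L -> finlin L' ->
  (forall phi, L (prodfun phi) = L' (prodfun phi)) -> forall f, L f = L' f.
Proof.
move=> fL fL' LL' f; apply/eqP; rewrite -subr_eq0; apply/eqP.
have [s sE] := finlinB fL fL'.
have s0 phi : \sum_(c <- s) c.1 * prodfun phi c.2 = 0.
  by rewrite -sE LL' subrr.
rewrite sE; pose ps := undup [seq c.2 | c <- s].
have indE (p q : 'rV[R]_n) :
    prodfun (fun i u => (u == q 0 i)%:R) p = (p == q)%:R.
  rewrite /prodfun; case: eqP => [->|/eqP pq].
    by rewrite big1 // => i _; rewrite eqxx.
  have [i pqi] : exists i, p 0 i != q 0 i.
    apply/existsP; apply: contraNT pq; rewrite negb_exists => /forallP pq.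
    apply/eqP/rowP => i; have := pq i; rewrite negbK => /eqP->.
    by [].
  by rewrite (bigD1 i) //= (negbTE pqi) mul0r.
transitivity (\sum_(q <- ps) f q * \sum_(c <- s) c.1 * (c.2 == q)%:R).
  under [RHS]eq_bigr => q _ do rewrite mulr_sumr.
  rewrite exchange_big /=; apply: eq_big_seq => c cs.
  have cps : c.2 \in ps by rewrite mem_undup; apply: map_f.
  rewrite (bigD1_seq c.2) ?undup_uniq //= eqxx mulr1 big1 ?addr0 1?mulrC //.
  by move=> q; rewrite eq_sym => /negbTE ->; rewrite !mulr0.
rewrite big1 // => q _; under eq_bigr => c _ do rewrite -indE.
by rewrite s0 mulr0.
Qed.

(** [H] stands for whatever is done to [f] before differencing: clamping, passing to [Delta 0 z f],
    or freezing coordinates at 0. *)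
Lemma finlin_pdiffs m (H : ('rV[R]_n -> R) -> 'rV[R]_m -> R) s eps z :
  (forall z, finlin (H^~ z)) -> finlin (fun f => pdiffs s eps (H f) z).
Proof.
move=> fH; elim: s z => [|i s ih] z /=; first exact: fH.
by rewrite /pdiff; apply: finlinB; apply: ih.
Qed.

Lemma finlin_Delta m (H : ('rV[R]_n -> R) -> 'rV[R]_m -> R) (x y : 'rV[R]_m) :
  (forall z, finlin (H^~ z)) -> finlin (fun f => Delta x y (H f)).
Proof. exact: finlin_pdiffs. Qed.

Lemma shiftE z t (i j : 'I_n) :
  (z + t *: unitv R i) 0 j = if i == j then z 0 j + t else z 0 j.
Proof.
by rewrite /unitv !mxE eqxx eq_sym; case: eqP; rewrite /= ?mulr1 ?mulr0 ?addr0.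
Qed.

Lemma pdiffs_prod s eps phi z : uniq s ->
  pdiffs s eps (prodfun phi) z =
  \prod_i (if i \in s then phi i (z 0 i + eps i) - phi i (z 0 i)
           else phi i (z 0 i)).
Proof.
elim: s z => [|i s ih] z /=.
  by [].
move=> /andP[nis us]; rewrite /pdiff !ih // !(bigD1 (P:=xpredT) i) //=.
rewrite (negbTE nis) mem_head shiftE eqxx.
rewrite (eq_bigr (fun j => if j \in s then phi j (z 0 j + eps j) - phi j (z 0 j)
           else phi j (z 0 j))); last first.
  by move=> j ji; rewrite shiftE eq_sym (negbTE ji).
rewrite -mulrBl; congr (_ * _); apply: eq_bigr => j ji.
by rewrite inE (negbTE ji).
Qed.

Lemma Delta_prod x y phi :
  Delta x y (prodfun phi) = \prod_i (phi i (y 0 i) - phi i (x 0 i)).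
Proof.
rewrite /Delta pdiffs_prod ?enum_uniq //; apply: eq_bigr => i _.
by rewrite mem_enum [x 0 i + _]addrC subrK.
Qed.

Lemma finlin_DeltaE x y : finlin (Delta x y).
Proof. by apply: (@finlin_Delta n id) => z; apply: finlin_eval. Qed.

Lemma pdiffsB s eps f g z :
  pdiffs s eps (fun z => f z - g z) z = pdiffs s eps f z - pdiffs s eps g z.
Proof.
elim: s z => [|i s ih] z //=; by rewrite /pdiff !ih; ring.
Qed.

Lemma DeltaB x y f g :
  Delta x y (fun z => f z - g z) = Delta x y f - Delta x y g.
Proof. exact: pdiffsB. Qed.

Definition mix (J : {set 'I_n}) x y : 'rV[R]_n :=
  \row_i (if i \in J then y 0 i else x 0 i).

Lemma DeltaE x y f :
  Delta x y f = \sum_(J : {set 'I_n}) (-1) ^+ (n - #|J|) * f (mix J x y).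
Proof.
move: f; apply: finlin_eq; first exact: finlin_DeltaE.
  by apply: finlin_sum => J; apply: finlinZ; apply: finlin_eval.
move=> phi; rewrite Delta_prod bigA_distr.
apply: eq_big => [J|J _]; first by rewrite inE.
rewrite /prodfun.
have -> : (-1) ^+ (n - #|J|) = \prod_i (if i \in J then 1 else -1) :> R.
  rewrite (bigID (mem J)) /= big1 ?mul1r => [|i ->//].
  rewrite (eq_big (mem (finset.setC J)) (fun=> -1)) => [|i|i /negbTE ->//].
    by rewrite prodr_const cardsCs finset.setCK card_ord.
  by rewrite !inE.
rewrite -big_split /=; apply: eq_bigr => i _; rewrite mxE.
by case: ifP; rewrite ?mul1r ?mulN1r.
Qed.

End FiniteFunctionals.

(** The number of subintervals depends on the coordinate, so multi-indices of grid cells are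
    dependent functions. This is the distributive law for them. *)
Lemma dffun_distr (R : comPzSemiRingType) (I : finType) (T_ : I -> finType)
    (P : forall i, T_ i -> R) :
  \sum_(k : {dffun forall i, T_ i}) \prod_i P i (k i) =
  \prod_i \sum_(j : T_ i) P i j.
Proof.
pose P' i : {ffun T_ i -> R} := [ffun j => P i j].
rewrite (reindex (@dffun_of_fprod I T_)); last first.
  by apply: onW_bij; apply: dffun_of_fprod_bij.
transitivity (\sum_(t : fprod T_) \prod_(i in I) P' i (t i)).
  by apply: eq_bigr => t _; apply: eq_bigr => i _; rewrite !ffunE.
rewrite big_fprod.
rewrite -(bigA_distr_big_dep (fun i => tagged_with T_ i) (fun i g => untag 0
  (P' i) g)) /=; apply: eq_bigr => i _.
transitivity (\sum_j P' i j); last by apply: eq_bigr => j _; rewrite ffunE.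
by rewrite (big_tag (fun i j => P' i j)).
Qed.

Section Telescope.
Variable R : realType.

Lemma partition_telescope (phi : R -> R) x0 s a b :
  path <%R x0 s -> a \in x0 :: s -> b \in x0 :: s -> a <= b ->
  \sum_(j < size s | (a <= nth 0 (x0 :: s) j) && (nth 0 s j <= b))
    (phi (nth 0 s j) - phi (nth 0 (x0 :: s) j)) = phi b - phi a.
Proof.
move=> srt ain bin ab.
have srt' : sorted <%R (x0 :: s) by [].
pose ia := index a (x0 :: s); pose ib := index b (x0 :: s).
have ias : (ia < (size s).+1)%N by rewrite /ia /ib (_ : (size s).+1 = size (x0
  :: s)) // index_mem.
have ibs : (ib < (size s).+1)%N by rewrite /ia /ib (_ : (size s).+1 = size (x0
  :: s)) // index_mem.
have aE : nth 0 (x0 :: s) ia = a by rewrite nth_index.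
have bE : nth 0 (x0 :: s) ib = b by rewrite nth_index.
have leE i j : (i < (size s).+1)%N -> (j < (size s).+1)%N ->
    (nth 0 (x0 :: s) i <= nth 0 (x0 :: s) j) = (i <= j)%N.
  move=> si sj; rewrite (lt_sorted_leq_nth _ srt') //.
have iab : (ia <= ib)%N by rewrite -leE // aE bE.
rewrite -aE -bE -(telescope_sumr (fun j => phi (nth 0 (x0 :: s) j)) iab).
rewrite [RHS](big_nat_widenl _ 0) // [RHS](big_nat_widen _ _ (size s)) //.
rewrite [RHS]big_mkord; apply: eq_big => j //.
have js := ltn_ord j.
rewrite leE //; last exact: ltnW.
by rewrite -[nth 0 s j]/(nth 0 (x0 :: s) j.+1) leE.
Qed.

Variable n : nat.
Implicit Types (f : 'rV[R]_n -> R) (x y a b : 'rV[R]_n).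

(** The corners of cell [k] as they occur in [grid_variation]: prepending [a 0 i] shifts the index
    by one, so that [glo] and [ghi] pick consecutive partition points. *)
Definition glo a (s : 'I_n -> seq R) (k : {dffun forall i, 'I_(size (s i))}) :
  'rV[R]_n := \row_i nth 0 (a 0 i :: s i) (k i).

Definition ghi (s : 'I_n -> seq R) (k : {dffun forall i, 'I_(size (s i))}) :
  'rV[R]_n := \row_i nth 0 (s i) (k i).

Definition in_cell a b x0 s k :=
  [forall i, (a 0 i <= glo x0 (s := s) k 0 i) && (ghi k 0 i <= b 0 i)].

(** On a product function the sum over the cells factors into one telescoping sum per coordinate.
    The corners may be any grid points, so that many boxes can be resolved on one common grid, as in
    [Delta_subadd]. *)
Lemma Delta_cells x0 (s : 'I_n -> seq R) a b f :
  (forall i, path <%R (x0 0 i) (s i)) ->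
  (forall i, a 0 i \in x0 0 i :: s i) -> (forall i, b 0 i \in x0 0 i :: s i) ->
  vle a b ->
  Delta a b f =
  \sum_(k : {dffun forall i, 'I_(size (s i))} | in_cell a b x0 k)
    Delta (glo x0 k) (ghi k) f.
Proof.
move=> srt ain bin ab; move: f; apply: finlin_eq; first exact: finlin_DeltaE.
  by apply: finlin_sum => k; apply: finlin_DeltaE.
move=> phi; rewrite Delta_prod [RHS]big_mkcond /=.
pose P i (j : 'I_(size (s i))) :=
  if (a 0 i <= nth 0 (x0 0 i :: s i) j) && (nth 0 (s i) j <= b 0 i)
  then phi i (nth 0 (s i) j) - phi i (nth 0 (x0 0 i :: s i) j) else 0.
transitivity (\sum_(k : {dffun forall i, 'I_(size (s i))}) \prod_i P i (k i)).
  rewrite dffun_distr; apply: eq_bigr => i _.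
  by rewrite -big_mkcond /= (partition_telescope (phi i) (srt i)).
apply: eq_bigr => k _; rewrite Delta_prod; case: ifPn => [/forallP kP|].
  by apply: eq_bigr => i _; move: (kP i); rewrite !mxE /P => ->.
rewrite negb_forall => /existsP[i]; rewrite !mxE => /negbTE ki.
by rewrite (bigD1 i) //= /P ki mul0r.
Qed.

Lemma grid_telescope a b s f : (forall i, itv_partition (a 0 i) (b 0 i) (s i))
  ->
  \sum_(k : {dffun forall i : 'I_n, 'I_(size (s i))})
    Delta (glo a k) (ghi k) f = Delta a b f.
Proof.
move=> sP; rewrite (@Delta_cells a s a b f).
- apply/esym; apply: eq_bigl => k; apply/forallP => i; rewrite !mxE.
  have [ps /eqP ls] := sP i; have ki := ltn_ord (k i).
  rewrite -[nth 0 (s i) (k i)]/(nth 0 (a 0 i :: s i) (k i).+1).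
  rewrite !(set_nth_default (b 0 i)) //=; try exact: ltnW.
  apply/andP; split.
    by apply: itv_partition_nth_ge (sP i); exact: ltnW.
  rewrite -[nth _ (s i) (k i)]/(nth (b 0 i) (a 0 i :: s i) (k i).+1).
  exact: itv_partition_nth_le (sP i).
- by move=> i; have [] := sP i.
- by move=> i; rewrite mem_head.
- by move=> i; have [_ /eqP <-] := sP i; rewrite mem_last.
- by move=> i; exact: itv_partition_le (sP i).
Qed.

End Telescope.

Section DeltaTheory.
Variables (R : realType) (n : nat).
Implicit Types (f : 'rV[R]_n -> R) (x y z a b : 'rV[R]_n).

Lemma vle_trans y x z : vle x y -> vle y z -> vle x z.
Proof. by move=> xy yz i; apply: le_trans (yz i). Qed.

Lemma vle0 x : vle 0 x <-> orthant x.
Proof. by split=> h i; have := h i; rewrite mxE. Qed.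

Definition upd x i (c : R) : 'rV[R]_n := \row_j (if j == i then c else x 0 j).

Lemma upd_shift x i t : x + t *: unitv R i = upd x i (x 0 i + t).
Proof.
by apply/rowP => j; rewrite shiftE mxE eq_sym; case: eqP => [->|].
Qed.

Lemma Delta_cut x y i c f :
  Delta x y f = Delta x (upd y i c) f + Delta (upd x i c) y f.
Proof.
move: f; apply: finlin_eq; first exact: finlin_DeltaE.
  by apply: finlinD; exact: finlin_DeltaE.
move=> phi; rewrite !Delta_prod !(bigD1 (P:=xpredT) i) //= !mxE eqxx.
under [X in _ = _ * X + _]eq_bigr => j ji do rewrite mxE (negbTE ji).
under [X in _ = _ + _ * X]eq_bigr => j ji do rewrite mxE (negbTE ji).
by rewrite -mulrDl; congr (_ * _); ring.
Qed.

Lemma Delta_degenerate x y i f : x 0 i = y 0 i -> Delta x y f = 0.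
Proof.
move=> xyi; move: f; apply: finlin_eq; first exact: finlin_DeltaE.
  by exists [::] => f; rewrite big_nil.
by move=> phi; rewrite Delta_prod (bigD1 i) //= xyi subrr mul0r.
Qed.

(** [Delta 0 z f] differs from [f z] by terms each of which ignores some coordinate of [z], and such
    terms have no increments. Hence f_I and F^{f_I} induce the same measure. *)
Lemma Delta_Delta0 x y f : Delta x y (fun z => Delta 0 z f) = Delta x y f.
Proof.
move: f; apply: finlin_eq; last 1 first.
- move=> phi; rewrite Delta_prod.
  rewrite (_ : (fun z => _) = prodfun (fun i u => phi i u - phi i 0)).
    by rewrite Delta_prod; apply: eq_bigr => i _; ring.
  by apply/funext => z; rewrite Delta_prod; apply: eq_bigr => i _; rewrite mxE.
- by apply: finlin_Delta => z; exact: finlin_DeltaE.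
- exact: finlin_DeltaE.
Qed.

(** The clamp to the orthant, by which a function given on the orthant is extended to all row
    vectors. *)
Definition pos x : 'rV[R]_n := \row_i Num.max 0 (x 0 i).

Lemma orthant_pos x : orthant (pos x).
Proof. by move=> i; rewrite mxE le_max lexx. Qed.

Lemma pos_id x : orthant x -> pos x = x.
Proof. by move=> x0; apply/rowP => i; rewrite mxE; apply/max_idPr. Qed.

Lemma vle_pos x y : vle x y -> vle (pos x) (pos y).
Proof.
by move=> xy i; rewrite !mxE ge_max le_max lexx /= le_max (xy i) orbT.
Qed.

Lemma Delta_pos x y f : Delta x y (f \o pos) = Delta (pos x) (pos y) f.
Proof.
move: f; apply: finlin_eq; last 1 first.
- move=> phi; rewrite Delta_prod.
  rewrite (_ : _ \o _ = prodfun (fun i u => phi i (Num.max 0 u))).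
    by rewrite Delta_prod; apply: eq_bigr => i _; rewrite !mxE.
  by apply/funext => z; apply: eq_bigr => i _; rewrite mxE.
- by apply: (@finlin_Delta _ _ _ (fun f => f \o pos)) => z; exact: finlin_eval.
- exact: finlin_DeltaE.
Qed.

Lemma mix_box J x y : vle x y -> vle x (mix J x y) /\ vle (mix J x y) y.
Proof. by move=> xy; split=> i; rewrite mxE; case: ifP. Qed.

Lemma eq_Delta f g x y : vle x y ->
  (forall z, vle x z -> vle z y -> f z = g z) -> Delta x y f = Delta x y g.
Proof.
move=> xy fg; rewrite !DeltaE; apply: eq_bigr => J _.
by have [? ?] := mix_box J xy; rewrite fg.
Qed.

(** [k_increasing] speaks of positive steps only, so boxes with a side of length 0 are treated
    apart. *)
Lemma Delta_monotone_ge0 f x y : (0 < n)%N -> Delta_monotone f ->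
  orthant x -> vle x y -> 0 <= Delta x y f.
Proof.
move=> n0 fm x0 xy; have [/existsP[i /eqP xyi]|] := boolP [exists i, x 0 i == y
  0 i].
  by rewrite (Delta_degenerate _ xyi).
rewrite negb_exists => /forallP xyN.
have := fm n; rewrite n0 leqnn => /(_ isT).
have sE : size (enum 'I_n) == n by rewrite size_enum_ord.
move=> /(_ (Tuple sE)); apply => //; first exact: enum_uniq.
by move=> i; rewrite subr_gt0 lt_neqAle xyN /=.
Qed.

Definition boxoc a b : set 'rV[R]_n := [set z | forall i, a 0 i < z 0 i <= b 0
  i].

(* Cut all boxes along the coordinates of all corners: a cell of this grid
   is contained in a box as soon as its upper corner is. *)
Lemma Delta_subadd (J : finType) f a b (A B : J -> 'rV[R]_n) :
  (forall x y, vle x y -> 0 <= Delta x y f) -> vle a b ->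
  (forall j, vle (A j) (B j)) ->
  boxoc a b `<=` \bigcup_j boxoc (A j) (B j) ->
  Delta a b f <= \sum_j Delta (A j) (B j) f.
Proof.
move=> f0 ab AB cov.
pose vs := [:: a, b & [seq A j | j : J] ++ [seq B j | j : J]].
pose S := sort <=%R (undup [seq x 0 i | x <- vs, i <- enum 'I_n]).
have Ssort : sorted <%R S by rewrite sort_lt_sorted undup_uniq.
have vS x i : x \in vs -> x 0 i \in S.
  move=> xvs; rewrite mem_sort mem_undup; apply/allpairsP.
  by exists (x, i); rewrite mem_enum.
have aS i : a 0 i \in S by apply: vS; rewrite mem_head.
have bS i : b 0 i \in S by apply: vS; rewrite inE mem_head orbT.
have AS j i : A j 0 i \in S.
  by apply: vS; rewrite !inE mem_cat (map_f A) ?mem_enum ?orbT.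
have BS j i : B j 0 i \in S.
  by apply: vS; rewrite !inE mem_cat (map_f B) ?mem_enum ?orbT.
pose x0 : 'rV[R]_n := const_mx (head 0 S).
pose s (_ : 'I_n) := behead S.
have SE (i : 'I_n) : x0 0 i :: s i = S.
  by rewrite mxE /s; have := aS i; case: (S).
have pS i : path <%R (x0 0 i) (s i).
  by rewrite -[path _ _ _]/(sorted <%R (x0 0 i :: s i)) SE.
have cells x y : (forall i, x 0 i \in S) -> (forall i, y 0 i \in S) -> vle x y
  ->
    Delta x y f = \sum_(k | in_cell (s := s) x y x0 k)
      Delta (glo x0 k) (ghi k) f.
  by move=> xS yS xy; apply: Delta_cells => // i; rewrite SE.
have lohi k : vle (glo x0 (s := s) k) (ghi k).
  move=> i; rewrite !mxE.
  have := pS i => /(pathP 0) /(_ (k i) (ltn_ord _)) /ltW.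
  by rewrite !mxE.
rewrite cells //.
under [leRHS]eq_bigr => j _ do rewrite cells //.
under [leRHS]eq_bigr => j _ do rewrite big_mkcond.
rewrite exchange_big /= big_mkcond /=; apply: ler_sum => k _.
case: ifPn => [/forallP kab|_]; last first.
  by apply: sumr_ge0 => j _; case: ifP => // _; exact: f0.
have [j _ jk] : (\bigcup_j boxoc (A j) (B j)) (ghi k).
  apply: cov => i; have /andP[ak ->] := kab i; rewrite andbT.
  apply: le_lt_trans ak _; rewrite !mxE.
  have := pS i => /(pathP 0) /(_ (k i) (ltn_ord _)).
  by rewrite !mxE.
rewrite (bigD1 j) //= ifT ?lerDl.
  by apply: sumr_ge0 => j' _; case: ifP => // _; exact: f0.
apply/forallP => i; have /andP[Ak ->] := jk i; rewrite andbT.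
move: Ak; rewrite !mxE.
(* [A j 0 i] is itself a grid value. Being strictly below the upper end of the cell, it is at most
   the predecessor of that end in [S], which is the lower end. *)
have [m mS mE] : exists2 m, (m < size S)%N & nth 0 S m = A j 0 i.
  by exists (index (A j 0 i) S); rewrite ?nth_index ?index_mem.
have ks : (k i < (size S).-1)%N by rewrite -size_behead; exact: ltn_ord (k i).
have kS : ((k i).+1 < size S)%N by rewrite -ltn_predRL.
have -> : head 0 S :: s i = S by rewrite -(SE i) mxE.
rewrite nth_behead -mE (lt_sorted_ltn_nth _ Ssort) ?inE // ltnS => mk.
by rewrite (lt_sorted_leq_nth _ Ssort) ?inE // ltnW.
Qed.

Lemma Delta_le f a b a' b' :
  (forall x y, vle x y -> 0 <= Delta x y f) -> vle a b -> vle a' b' ->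
  boxoc a b `<=` boxoc a' b' -> Delta a b f <= Delta a' b' f.
Proof.
move=> f0 ab ab' sub.
have := @Delta_subadd unit f a b (fun=> a') (fun=> b') f0 ab (fun=> ab').
rewrite (big_pred1 tt) => [|[]//]; apply.
by move=> z /sub ?; exists tt.
Qed.

End DeltaTheory.

(** * Iterated limits *)

Section IterlimTheory.
Variables (R : realType) (T : eqType).
Implicit Types (p e : T -> R) (s : seq T) (G : (T -> R) -> R) (L : R).

Lemma iterlim_unique p s G e L L' :
  iterlim p s G e L -> iterlim p s G e L' -> L = L'.
Proof.
elim: s e L L' => [|t s ih] e L L' /=; first by move=> -> ->.
move=> [phi [phiG phiL]] [phi' [phi'G phi'L]].
have phiL' : phi u @[u --> (p t)^'+] --> L'.
  apply: cvg_trans phi'L; apply: near_eq_cvg; apply: filterS2 phiG phi'G => u.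
  by move=> Gu G'u; apply: ih G'u Gu.
exact: (cvg_unique _ phiL phiL').
Qed.

(** Only points whose limit variables lie strictly beyond their limit points are visited; this is
    what allows functions that agree on the orthant to be exchanged. *)
Lemma eq_iterlim p s G G' e L :
  (forall e', (forall t, t \in s -> p t < e' t) ->
     (forall t, t \notin s -> e' t = e t) -> G e' = G' e') ->
  uniq s -> iterlim p s G e L -> iterlim p s G' e L.
Proof.
elim: s e L => [|t s ih] e L GG' /=.
  by move=> _ <-; rewrite GG'.
move=> /andP[tns us] [phi [phiG phiL]]; exists phi; split => //.
have tp : \forall u \near (p t)^'+, p t < u by exact: nbhs_right_gt.
apply: filterS2 phiG tp => u Gu pu; apply: ih Gu => // e' e'p e'e.
apply: GG' => t'; rewrite inE.
  by case: eqP => [->|_] /=; [rewrite e'e //= eqxx | exact: e'p].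
by rewrite negb_or => /andP[/negbTE t't t's]; rewrite e'e //= t't.
Qed.

Lemma iterlimB p s G G' e L L' :
  iterlim p s G e L -> iterlim p s G' e L' ->
  iterlim p s (fun e => G e - G' e) e (L - L').
Proof.
elim: s e L L' => [|t s ih] e L L' /=; first by move=> -> ->.
move=> [phi [phiG phiL]] [phi' [phi'G phi'L]].
exists (fun u => phi u - phi' u); split; last exact: cvgB.
by apply: filterS2 phiG phi'G => u; exact: ih.
Qed.

(** Right continuity in each variable separately is enough: the inner iterated limit is an
    evaluation at [p], and the function of the outer variable left behind is again right-continuous.
    Nothing depends on the order of [s]. *)
Lemma iterlim_rcontinuous p s G e :
  (forall e, (forall t, p t <= e t) -> forall t,
     G [eta e with t |-> u] @[u --> (e t)^'+] --> G e) ->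
  (forall t, p t <= e t) ->
  iterlim p s G e (G (fun t => if t \in s then p t else e t)).
Proof.
move=> Gc; elim: s e => [|t s ih] e pe /=.
  by congr (G _); apply/funext => t.
pose r u := fun z => if z \in s then p z else [eta e with t |-> u] z.
exists (fun u => G (r u)); split.
  have : \forall u \near (p t)^'+, p t < u by exact: nbhs_right_gt.
  apply: filterS => u pu.
  by apply: ih => t' /=; case: eqP => [->|_]; [exact: ltW|].
have -> : (fun z => if z \in t :: s then p z else e z) = r (p t).
  apply/funext => z; rewrite /r inE /=; case: eqP => [->|_] //=.
  by rewrite if_same.
(* If [t] occurs again in [s], the inner limit overwrites [u] and the outer function is constant. *)
have [ts|ts] := boolP (t \in s).
  rewrite (_ : (fun u => G (r u)) = fun=> G (r (p t))); first exact: cvg_cst.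
  apply/funext => u; congr (G _); apply/funext => z; rewrite /r /=.
  by case: ifP => // zs; case: eqP => // zt; rewrite zt ts in zs.
have rt : r (p t) t = p t by rewrite /r (negbTE ts) /= eqxx.
have pr t' : p t' <= r (p t) t'.
  by rewrite /r /=; case: ifP => // _; case: eqP => [->|].
have := Gc _ pr t; rewrite rt.
rewrite (_ : (fun u => G (r u)) = fun u => G [eta r (p t) with t |-> u]) //.
apply/funext => u; congr (G _); apply/funext => z; rewrite /r /=.
by case: eqP => [->|//]; rewrite (negbTE ts).
Qed.

Section Monotone.
Variables (p : T -> R) (G : (T -> R) -> R).
Hypothesis Ghomo : forall e e', (forall t, p t <= e t) ->
  (forall t, e t <= e' t) -> G e <= G e'.

Let above s e := [set G e' | e' in
  [set e' | (forall t, t \in s -> p t < e' t) /\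
            (forall t, t \notin s -> e' t = e t)]].

Let pplus s e t : R := if t \in s then p t + 1 else e t.

Let above_neq0 s e : above s e !=set0.
Proof.
exists (G (pplus s e)), (pplus s e) => //; split=> t ts; rewrite /pplus.
  by rewrite ts ltrDl.
by rewrite (negbTE ts).
Qed.

Let above_lb s e : (forall t, p t <= e t) ->
  lbound (above s e) (G (fun t => if t \in s then p t else e t)).
Proof.
move=> pe _ [e' [e's e'e] <-]; apply: Ghomo => t.
  by case: ifP.
by case: ifPn => [/e's/ltW|/e'e ->].
Qed.

Let above_has_inf s e : (forall t, p t <= e t) -> has_inf (above s e).
Proof. by move=> pe; split=> //; eexists; exact: above_lb. Qed.

(** For a monotone [G] each one-sided limit is an infimum, and an infimum of infima is the joint
    infimum. *)
Lemma iterlim_monotone s e : uniq s -> (forall t, p t <= e t) ->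
  iterlim p s G e (inf (above s e)).
Proof.
elim: s e => [|t s ih] e /=.
  move=> _ _; rewrite (_ : above _ _ = [set G e]) ?inf1 //.
  apply/seteqP; split=> [_ [e' [_ e'e] <-]|_ ->].
    by congr (G _); apply/funext => t; apply: e'e.
  by exists e.
move=> /andP[ts us] pe.
have pe' u : p t < u -> forall t', p t' <= [eta e with t |-> u] t'.
  by move=> pu t' /=; case: eqP => [->|//]; exact: ltW.
exists (fun u => inf (above s [eta e with t |-> u])); split.
  have : \forall u \near (p t)^'+, p t < u by exact: nbhs_right_gt.
  by apply: filterS => u pu; apply: ih => //; exact: pe'.
apply/cvgrPdist_le => eps eps0.
have [_ [e1 [e1p e1e] <-] e1lt] := inf_adherent eps0 (above_has_inf (t :: s)
  pe).
have pt1 : p t < e1 t by apply: e1p; rewrite mem_head.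
near=> u.
have pu : p t < u by near: u; exact: nbhs_right_gt.
have ue1 : u <= e1 t by near: u; exact: nbhs_right_le.
have le1 : inf (above (t :: s) e) <= inf (above s [eta e with t |-> u]).
  apply: lb_le_inf; first exact: above_neq0.
  move=> _ [e' [e's e'e] <-].
  apply: ge_inf; first by eexists; apply: above_lb.
  exists e' => //; split=> t'.
    by rewrite inE; case: eqP => [->|_ /= /e's //] _; rewrite e'e //= eqxx.
  rewrite inE negb_or => /andP[/negbTE t't t's].
  by rewrite e'e //= t't.
have le2 : inf (above s [eta e with t |-> u]) <= G e1.
  (* Lowering coordinate [t] of the nearly optimal point [e1] to [u] makes it admissible for the
     inner infimum and does not increase [G]. *)
  pose e2 := [eta e1 with t |-> u].
  apply: (@le_trans _ _ (G e2)); last first.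
    apply: Ghomo => t'; rewrite /e2 /=; case: eqP => [->|_] //.
    have [t's|t's] := boolP (t' \in t :: s); first exact/ltW/e1p.
    by rewrite e1e.
  apply: ge_inf; first by eexists; apply: above_lb; exact: pe'.
  exists e2 => //; split=> t' t's; rewrite /e2 /=.
    by case: eqP => [->|_] //; apply: e1p; rewrite inE t's orbT.
  by case: eqP => // /eqP t't; rewrite e1e // inE negb_or t't.
rewrite distrC ger0_norm ?subr_ge0 // lerBlDl.
exact: le_trans le2 (ltW e1lt).
Unshelve. all: by end_near. Qed.

(** The conditions on [L] do not mention [s], so a single value serves for all orders of the
    limits. *)
Lemma iterlim_monotone_inf s L : uniq s -> (forall t, t \in s) ->
  (forall e, (forall t, p t < e t) -> L <= G e) ->
  (forall eps, 0 < eps -> exists2 e, (forall t, p t < e t) & G e < L + eps) ->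
  iterlim p s G p L.
Proof.
move=> us sT lbL adhL.
rewrite [L](_ : _ = inf (above s p)); first by apply: iterlim_monotone.
have pp t : p t <= p t by [].
apply/eqP; rewrite eq_le; apply/andP; split.
  apply: lb_le_inf; first exact: above_neq0.
  by move=> _ [e [es _] <-]; apply: lbL => t; apply: es.
apply/ler_addgt0Pr => eps /adhL[e pe /ltW]; apply: le_trans.
apply: ge_inf; first by eexists; apply: above_lb.
by exists e => //; split=> // t; rewrite sT.
Qed.

End Monotone.

End IterlimTheory.

(** * Borel sets of row vectors and half-open boxes *)

Section Borel.
Variables (R : realType) (n : nat).
Implicit Types (x y z a b : 'rV[R]_n).

Definition borel_rV := g_sigma_algebraType [set U : set 'rV[R]_n | open U].

Lemma measurable_open (U : set borel_rV) : open (U : set 'rV[R]_n) ->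
  measurable U.
Proof. exact: sub_gen_smallest. Qed.

Lemma open_coord_gt (i : 'I_n) c : open [set z : 'rV[R]_n | c < z 0 i].
Proof.
apply: (@open_comp _ _ (fun z : 'rV[R]_n => z 0 i) [set t | c < t]).
  by move=> z _; exact: coord_continuous.
exact: open_gt.
Qed.

Lemma open_coord_lt (i : 'I_n) c : open [set z : 'rV[R]_n | z 0 i < c].
Proof.
apply: (@open_comp _ _ (fun z : 'rV[R]_n => z 0 i) [set t | t < c]).
  by move=> z _; exact: coord_continuous.
exact: open_lt.
Qed.

Lemma measurable_coord_gt (i : 'I_n) c :
  measurable ([set z | c < z 0 i] : set borel_rV).
Proof. by apply: measurable_open; exact: open_coord_gt. Qed.

Lemma measurable_coord_le (i : 'I_n) c :
  measurable ([set z | z 0 i <= c] : set borel_rV).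
Proof.
have <- : ~` [set z : borel_rV | c < z 0 i] = [set z | z 0 i <= c].
  by apply/seteqP; split=> z /=; rewrite leNgt => /negP.
by apply: measurableC; exact: measurable_coord_gt.
Qed.

Lemma measurable_coord_ge (i : 'I_n) c :
  measurable ([set z | c <= z 0 i] : set borel_rV).
Proof.
have <- : ~` [set z : borel_rV | z 0 i < c] = [set z | c <= z 0 i].
  by apply/seteqP; split=> z /=; rewrite leNgt => /negP.
by apply: measurableC; apply: measurable_open; exact: open_coord_lt.
Qed.

Lemma measurable_forall (A : 'I_n -> set borel_rV) :
  (forall i, measurable (A i)) -> measurable [set z | forall i, A i z].
Proof.
move=> mA; have <- : \bigcap_(i in [set: 'I_n]) A i = [set z | forall i, A i z].
  by apply/seteqP; split => z /= Az i; [|move=> _]; exact: Az.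
by apply: fin_bigcap_measurable => //; exact: finite_finset.
Qed.

Lemma measurable_boxoc a b : measurable (boxoc a b : set borel_rV).
Proof.
apply: (@measurable_forall (fun i => [set z : borel_rV | a 0 i < z 0 i <= b 0
  i])).
move=> i; have <- : [set z : borel_rV | a 0 i < z 0 i] `&`
    [set z : borel_rV | z 0 i <= b 0 i] = [set z | a 0 i < z 0 i <= b 0 i].
  by apply/seteqP; split=> z /= => [[-> ->]|/andP[]].
by apply: measurableI; [exact: measurable_coord_gt|exact: measurable_coord_le].
Qed.

Lemma measurable_cbox a b : measurable (cbox a b : set borel_rV).
Proof.
apply: (@measurableI _ borel_rV [set z | vle a z] [set z | vle z b]).
  apply: (@measurable_forall (fun i => [set z : borel_rV | a 0 i <= z 0 i])) =>
    i.
  exact: measurable_coord_ge.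
apply: (@measurable_forall (fun i => [set z : borel_rV | z 0 i <= b 0 i])) => i.
exact: measurable_coord_le.
Qed.

(** Rational corners keep the union countable, so that measurability of boxes passes to open sets.
    The corners around a point are taken within the radius of a ball contained in [U]. *)
Lemma open_bigcup_boxoc (U : set 'rV[R]_n) : open U ->
  U = \bigcup_(pq in [set: 'rV[rat]_n * 'rV[rat]_n])
    (if `[< boxoc (map_mx ratr pq.1) (map_mx ratr pq.2) `<=` U >]
     then boxoc (map_mx ratr pq.1) (map_mx ratr pq.2) else set0).
Proof.
move=> oU; apply/seteqP; split=> [x Ux|x [pq _]]; last first.
  by case: asboolP => // sU; exact: sU.
have /nbhs_ballP[e /= e0 eU] : nbhs x U by exact: open_nbhs_nbhs.
have hp i : {q : rat | x 0 i - e < ratr q < x 0 i}.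
  apply: cid; have [|q /[!in_itv] /= ?] := @rat_in_itvoo R (x 0 i - e) (x 0 i).
    by rewrite ltrBlDr ltrDl.
  by exists q.
have hq i : {q : rat | x 0 i < ratr q < x 0 i + e}.
  apply: cid; have [|q /[!in_itv] /= ?] := @rat_in_itvoo R (x 0 i) (x 0 i + e).
    by rewrite ltrDl.
  by exists q.
exists (\row_i sval (hp i), \row_i sval (hq i)) => //=.
rewrite asboolT.
  move=> i; rewrite !mxE; case: (hp i) => /= p /andP[_ ->] /=.
  by case: (hq i) => /= q /andP[/ltW].
move=> z zpq; apply: eU; split => // j i; rewrite ord1 /ball /=.
have := zpq i; rewrite !mxE; case: (hp i) => /= p /andP[xp _].
case: (hq i) => /= q /andP[_ xq] /andP[pz zq].
rewrite /ball_ /= ltr_norml; apply/andP; split; lra.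
Qed.

End Borel.

Lemma cvg_at_right_shift (R : realType) (F : R -> R) (a l : R) :
  F (a + t) @[t --> (0 : R)^'+] --> l <-> F u @[u --> a^'+] --> l.
Proof.
split=> Fl P /Fl[/= e e0 eP]; exists e => //= u aeu au.
  have := eP (u - a); rewrite [a + _]addrC subrK; apply;
    last by rewrite subr_gt0.
  by move: aeu; rewrite /ball_ /= !sub0r opprB.
apply: eP; last by rewrite ltrDl.
by move: aeu; rewrite /ball_ /= sub0r opprD addNKr.
Qed.

Lemma cvg_rsum (R : realType) (T J : Type) (F : set_system T) (r : seq J)
    (P : pred J) (f : J -> T -> R) (l : J -> R) : Filter F ->
  (forall j, P j -> f j t @[t --> F] --> l j) ->
  (\sum_(j <- r | P j) f j t) @[t --> F] --> \sum_(j <- r | P j) l j.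
Proof.
move=> FF fl; elim: r => [|j r ih].
  by under eq_fun do rewrite big_nil; rewrite big_nil; exact: cvg_cst.
under eq_fun do rewrite big_cons; rewrite big_cons.
by case: ifP => // Pj; apply: cvgD => //; exact: fl.
Qed.

(** * Right continuity of increments in the corners of a box *)

Section RightContinuity.
Variables (R : realType) (n : nat).
Implicit Types (x y z a b : 'rV[R]_n) (G f : 'rV[R]_n -> R).

Definition rc_everywhere G := forall x (i : 'I_n),
  G (x + t *: unitv R i) @[t --> (0 : R)^'+] --> G x.

(** At a negative coordinate the clamped function is constant on a short step to the right; at a
    non-negative one, clamping commutes with the step. *)
Lemma rc_everywhere_pos f : rcontinuous f -> rc_everywhere (f \o @pos R n).
Proof.
move=> fc x i /=; have [xi0|xi0] := ltP (x 0 i) 0.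
  apply: cvg_near_cst; near=> t; congr (f _); apply/rowP => j.
  rewrite !mxE -[x 0 j + _]addr0; have := shiftE x t i j;
    rewrite !mxE addr0 => ->.
  case: eqP => // <-.
  have xt : x 0 i + t <= 0.
    by rewrite addrC -lerBrDr sub0r; near: t; apply: nbhs_right_le;
      rewrite oppr_gt0.
  by rewrite !(elimT max_idPl) // ltW.
have : f (pos x + t *: unitv R i) @[t --> (0 : R)^'+] --> f (pos x).
  exact/fc/orthant_pos.
apply: cvg_trans; apply: near_eq_cvg; near=> t.
congr (f _); apply/rowP => j; rewrite shiftE !mxE.
have := shiftE x t i j; rewrite !mxE => ->; case: eqP => // <-.
have t0 : 0 < t by near: t; exact: nbhs_right_gt.
rewrite !(elimT max_idPr) //; apply: addr_ge0 => //; exact: ltW.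
Unshelve. all: by end_near. Qed.

Lemma rc_everywhere_upd G x i : rc_everywhere G ->
  G (upd x i u) @[u --> (x 0 i)^'+] --> G x.
Proof.
move=> Gc; apply/cvg_at_right_shift; have := Gc x i.
by under eq_fun do rewrite upd_shift.
Qed.

Lemma mix_updr J a b i c :
  mix J a (upd b i c) = if i \in J then upd (mix J a b) i c else mix J a b.
Proof.
apply/rowP => j; case: ifPn => iJ; rewrite !mxE; case: eqP => // ->.
  by rewrite iJ.
by rewrite (negbTE iJ).
Qed.

Lemma mix_updl J a b i c :
  mix J (upd a i c) b = if i \in J then mix J a b else upd (mix J a b) i c.
Proof.
apply/rowP => j; case: ifPn => iJ; rewrite !mxE; case: eqP => // ->.
  by rewrite iJ.
by rewrite (negbTE iJ).
Qed.

Lemma cvg_Delta_updr G a b i : rc_everywhere G ->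
  Delta a (upd b i u) G @[u --> (b 0 i)^'+] --> Delta a b G.
Proof.
move=> Gc; rewrite DeltaE; under eq_fun do rewrite DeltaE.
apply: cvg_rsum => J _; apply: cvgMr.
under eq_fun do rewrite mix_updr.
have [iJ|iJ] := boolP (i \in J); last exact: cvg_cst.
by have := @rc_everywhere_upd G (mix J a b) i Gc; rewrite mxE iJ.
Qed.

Lemma cvg_Delta_updl G a b i : rc_everywhere G ->
  Delta (upd a i u) b G @[u --> (a 0 i)^'+] --> Delta a b G.
Proof.
move=> Gc; rewrite DeltaE; under eq_fun do rewrite DeltaE.
apply: cvg_rsum => J _; apply: cvgMr.
under eq_fun do rewrite mix_updl.
have [iJ|iJ] := boolP (i \in J); first exact: cvg_cst.
by have := @rc_everywhere_upd G (mix J a b) i Gc; rewrite mxE (negbTE iJ).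
Qed.

(** Right continuity is assumed separately in each coordinate, so the corner is moved one coordinate
    at a time; the strict inequality survives each sufficiently small move. *)
Lemma Delta_enlarge G a b (eps : R) : rc_everywhere G -> 0 < eps ->
  exists2 b' : 'rV[R]_n, (forall i, b 0 i < b' 0 i) & Delta a b' G < Delta a b
    G + eps.
Proof.
move=> Gc eps0.
suff [b' b'b Db'] : exists2 b' : 'rV[R]_n, (forall i, if i \in enum 'I_n then
    b 0 i < b' 0 i else b' 0 i == b 0 i) & Delta a b' G < Delta a b G + eps.
  by exists b' => // i; have := b'b i; rewrite mem_enum.
elim: (enum 'I_n) (enum_uniq 'I_n) => [_|i s ih /= /andP[nis us]].
  exists b => [i|]; [by rewrite in_nil|by rewrite ltrDl].
have [b' b'b Db'] := ih us.
have [u bu Du] : exists2 u, b' 0 i < u & Delta a (upd b' i u) G < Delta a b G +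
  eps.
  have := @cvg_Delta_updr G a b' i Gc => /(cvgr_lt _)/(_ _ Db') Hlt.
  near (b' 0 i)^'+ => u; exists u; first by near: u; exact: nbhs_right_gt.
  by near: u.
exists (upd b' i u) => // j; rewrite inE mxE; case: eqP => [->|_] /=.
  by have := b'b i; rewrite (negbTE nis) => /eqP <-.
exact: b'b.
Unshelve. all: by end_near. Qed.

Lemma Delta_shrink G a b (eps : R) : rc_everywhere G -> 0 < eps ->
  (forall i, a 0 i < b 0 i) ->
  exists2 a' : 'rV[R]_n, (forall i, a 0 i < a' 0 i < b 0 i) &
    Delta a b G - eps < Delta a' b G.
Proof.
move=> Gc eps0 ab.
suff [a' a'a Da'] : exists2 a' : 'rV[R]_n, (forall i, if i \in enum 'I_n then
    a 0 i < a' 0 i < b 0 i else a' 0 i == a 0 i) &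
    Delta a b G - eps < Delta a' b G.
  by exists a' => // i; have := a'a i; rewrite mem_enum.
elim: (enum 'I_n) (enum_uniq 'I_n) => [_|i s ih /= /andP[nis us]].
  exists a => [i|]; [by rewrite in_nil|by rewrite ltrBlDr ltrDl].
have [a' a'a Da'] := ih us.
have a'i : a' 0 i = a 0 i by have := a'a i; rewrite (negbTE nis) => /eqP.
have [u au Du] : exists2 u, a 0 i < u < b 0 i &
    Delta a b G - eps < Delta (upd a' i u) b G.
  have := @cvg_Delta_updl G a' b i Gc => /(cvgr_gt _)/(_ _ Da') Hlt.
  near (a' 0 i)^'+ => u; exists u; last by near: u.
  apply/andP; split; rewrite -?a'i; near: u; first exact: nbhs_right_gt.
  by apply: nbhs_right_lt; rewrite a'i.
exists (upd a' i u) => // j; rewrite inE mxE; case: eqP => [->|_] //=.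
Unshelve. all: by end_near. Qed.

End RightContinuity.

(** * Measures induced by right-continuous functions with positive increments *)

Section Stieltjes.
Variables (R : realType) (n : nat) (G : 'rV[R]_n -> R).
Hypotheses (n_gt0 : (0 < n)%N) (Gc : rc_everywhere G)
  (G_ge0 : forall x y, vle x y -> 0 <= Delta x y G).
Implicit Types (x y z a b : 'rV[R]_n).
Local Notation T := (borel_rV R n).

(** An infimum over all ways of writing [A] as a box: it avoids choosing corners, which an empty box
    does not determine, and it is +oo when [A] is not a box. *)
Let boxval (A : set T) : \bar R := ereal_inf
  [set x | exists a b, [/\ vle a b, A = boxoc a b & x = (Delta a b G)%:E]].

Let boxval_ge0 A : (0 <= boxval A)%E.
Proof.
by apply: le_ereal_inf_tmp => _ [a [b [ab _ ->]]]; rewrite lee_fin G_ge0.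
Qed.

Let boxvalE a b : vle a b -> boxval (boxoc a b) = (Delta a b G)%:E.
Proof.
move=> ab; apply/eqP; rewrite eq_le; apply/andP; split.
  by apply: ereal_inf_lbound; exists a, b.
apply: le_ereal_inf_tmp => _ [a' [b' [ab' AE ->]]].
by rewrite lee_fin; apply: Delta_le => //; rewrite AE.
Qed.

Let boxval0 : boxval set0 = 0%E.
Proof.
have i0 : 'I_n by case: (n) n_gt0 => // m _; exact: ord0.
have <- : boxoc 0 0 = set0 :> set 'rV[R]_n.
  apply/seteqP; split=> // z /(_ i0);
    rewrite mxE => /andP[z0 /(lt_le_trans z0)].
  by rewrite ltxx.
by rewrite boxvalE // (@Delta_degenerate _ _ _ _ i0).
Qed.

Let boxvalP A : boxval A != +oo%E -> exists ab : 'rV[R]_n * 'rV[R]_n,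
  vle ab.1 ab.2 /\ A = boxoc ab.1 ab.2.
Proof.
move=> Aoo; apply: contrapT => noab; move/eqP: Aoo; apply.
rewrite /boxval (_ : mkset _ = set0) ?ereal_inf0 //.
apply/seteqP; split=> // x [a [b [ab AE _]]]; apply: noab.
by exists (a, b).
Qed.

(** Covers may use any Borel sets, but a member that is not a box costs +oo, so in effect only
    covers by boxes count. *)
Let mu : set T -> \bar R := mu_ext boxval.

HB.instance Definition _ := isOuterMeasure.Build R T mu
  (mu_ext0 boxval0 boxval_ge0) (mu_ext_ge0 boxval_ge0) (le_mu_ext boxval)
  (mu_ext_sigma_subadditive boxval_ge0).

(** A half-space splits a box into two boxes whose increments add up. Applied to every member of a
    cover, this gives the Caratheodory criterion. *)
Let mu_coord_le (i : 'I_n) (c : R) :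
  caratheodory_measurable mu [set z : T | (z 0 i <= c)%R].
Proof.
pose H : set T := [set z : 'rV[R]_n | (z 0 i <= c)%R].
rewrite -/H.
have cut A : (boxval (A `&` H) + boxval (A `&` ~` H) <= boxval A)%E.
  apply: le_ereal_inf_tmp => _ [a [b [ab -> ->]]].
  (* The cut is clamped to the side of the box, so that both pieces have ordered corners even if the
     hyperplane misses the box. *)
  pose c' := Num.max (a 0 i) (Num.min (b 0 i) c).
  have ac : (a 0 i <= c')%R by rewrite le_max lexx.
  have cb : (c' <= b 0 i)%R by rewrite ge_max ge_min lexx (ab i).
  have c'E t : (a 0 i < t <= b 0 i)%R -> (t <= c')%R = (t <= c)%R.
    by move=> /andP[at_ tb]; rewrite le_max le_min tb leNgt at_.
  rewrite (Delta_cut a b i c') EFinD -!boxvalE; last 2 first.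
  - by move=> j; rewrite mxE; case: eqP => [->|].
  - by move=> j; rewrite mxE; case: eqP => [->|].
  have -> : boxoc a b `&` H = boxoc a (upd b i c').
    apply/seteqP; split=> z /=.
      move=> [abz zc] j; rewrite mxE; case: eqP => [ji|_]; last exact: abz.
      have := abz i; rewrite ji => zi; have /andP[-> _] := zi.
      by rewrite c'E.
    move=> az; have zi : (a 0 i < z 0 i <= b 0 i)%R.
      by have := az i; rewrite mxE eqxx => /andP[-> /le_trans]; apply.
    split=> [j|].
      by have := az j; rewrite mxE; case: eqP => [->|].
    by rewrite /H /= -(c'E _ zi); have := az i; rewrite mxE eqxx => /andP[].
  have -> : boxoc a b `&` ~` H = boxoc (upd a i c') b.
    apply/seteqP; split=> z /=.
      move=> [abz zc] j; rewrite mxE; case: eqP => [ji|_]; last exact: abz.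
      have := abz i; rewrite ji => zi; have /andP[_ ->] := zi.
      by rewrite andbT ltNge c'E //; apply/negP.
    move=> az; have zi : (a 0 i < z 0 i <= b 0 i)%R.
      by have := az i; rewrite mxE eqxx => /andP[/(le_lt_trans ac) ->].
    split=> [j|].
      by have := az j; rewrite mxE; case: eqP => [->|].
    rewrite /H /= -(c'E _ zi); apply/negP; rewrite -ltNge.
    by have := az i; rewrite mxE eqxx => /andP[].
  exact: lexx.
have mH : measurable H by exact: measurable_coord_le.
apply: le_caratheodory_measurable => X.
apply: le_ereal_inf_tmp => _ [A [mA XA] <-].
apply: (@le_trans _ _ (\sum_(k <oo) (boxval (A k `&` H) + boxval (A k `&` ~`
  H)))%E).
  rewrite nneseriesD //; apply: leeD; apply: ereal_inf_lbound.
    exists (fun k => A k `&` H) => //; split=> [k|]; first exact: measurableI.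
    by rewrite -setI_bigcupl; apply: setSI.
  exists (fun k => A k `&` ~` H) => //; split=> [k|].
    by apply: measurableI => //; exact: measurableC.
  by rewrite -setI_bigcupl; apply: setSI.
by apply: lee_nneseries => k *; [apply: adde_ge0|].
Qed.

(** Differences of half-spaces intersect to boxes, and countably many rational boxes make up an open
    set. *)
Let borel_caratheodory (A : set T) : measurable A ->
  caratheodory_measurable mu A.
Proof.
apply: smallest_sub => [|U oU].
  split=> [|X mX|F mF]; first exact: caratheodory_measurable_set0.
    by rewrite setTD; exact: caratheodory_measurable_setC.
  exact: caratheodory_measurable_bigcup.
pose C : measurableType _ := caratheodory_type mu.
suff : measurable (U : set C) by [].
rewrite (open_bigcup_boxoc oU).
apply: countable_bigcupT_measurable; first exact: countableP.
move=> pq; case: asboolP => // _.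
set a := map_mx _ _; set b := map_mx _ _.
have <- : \bigcap_(i in [set: 'I_n])
    ([set z : 'rV[R]_n | (z 0 i <= b 0 i)%R] `\` [set z | (z 0 i <= a 0 i)%R])
    = boxoc a b.
  apply/seteqP; split => z /= Az i; have := Az i.
    by move=> /(_ I)[/= -> /negP]; rewrite -ltNge => ->.
  by move=> /andP[az zb] _; split => //=; apply/negP; rewrite -ltNge.
apply: fin_bigcap_measurable => [|i _]; first exact: finite_finset.
by apply: measurableD; exact: mu_coord_le.
Qed.

(* Right continuity allows to shrink the box to a compact one and to enlarge the
   covering boxes to open ones at an arbitrarily small cost. *)
Let box_subadditive a b (A : nat -> set T) : vle a b ->
  boxoc a b `<=` \bigcup_k A k ->
  ((Delta a b G)%:E <= \sum_(k <oo) boxval (A k))%E.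
Proof.
move=> ab cov.
have [[k Ak]|] := pselect (exists k, boxval (A k) = +oo%E).
  by rewrite (nneseries_pinfty _ _ Ak) ?leey.
move=> /forallNP Afin.
have [c cP] : {c : nat -> 'rV[R]_n * 'rV[R]_n &
    forall k, vle (c k).1 (c k).2 /\ A k = boxoc (c k).1 (c k).2}.
  apply: (@choice _ _ (fun k (ab : 'rV[R]_n * 'rV[R]_n) =>
    vle ab.1 ab.2 /\ A k = boxoc ab.1 ab.2)) => k; apply: boxvalP; apply/eqP;
      exact: Afin.
have [/existsP[i /eqP abi]|] := boolP [exists i, a 0 i == b 0 i].
  by rewrite (Delta_degenerate _ abi); apply: nneseries_ge0.
rewrite negb_exists => /forallP abN.
have {}abN i : a 0 i < b 0 i by rewrite lt_neqAle abN ab.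
apply/lee_addgt0Pr => eps eps0.
have e2 : 0 < eps / 2 by rewrite divr_gt0.
have [a' a'ab Da'] := Delta_shrink Gc e2 abN.
(* Half of [eps] pays for shrinking the box; the other half is spread geometrically over the
   enlargements of the covering boxes. *)
have e2k k : 0 < eps / 2 / (2 ^ k.+1)%:R.
  by rewrite divr_gt0 // ltr0n expn_gt0.
have [B BP] : {B : nat -> 'rV[R]_n & forall k,
    (forall i, (c k).2 0 i < B k 0 i) /\
    Delta (c k).1 (B k) G < Delta (c k).1 (c k).2 G + eps / 2 / (2 ^ k.+1)%:R}.
  apply: (@choice _ _ (fun k (B : 'rV[R]_n) => (forall i, (c k).2 0 i < B 0 i)
    /\
    Delta (c k).1 B G < Delta (c k).1 (c k).2 G + eps / 2 / (2 ^ k.+1)%:R)) =>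
      k.
  by have [B cB DB] := Delta_enlarge (c k).1 (c k).2 Gc (e2k k); exists B.
pose O k := [set z : 'rV[R]_n | forall i, (c k).1 0 i < z 0 i < B k 0 i].
have Oopen k : open (O k).
  rewrite openE => z Oz.
  have nbz i : nbhs z [set y : 'rV[R]_n | (c k).1 0 i < y 0 i < B k 0 i].
    have /andP[cz zB] := Oz i.
    have gt : nbhs z [set y : 'rV[R]_n | (c k).1 0 i < y 0 i].
      by apply: open_nbhs_nbhs; split => //; exact: open_coord_gt.
    have lt : nbhs z [set y : 'rV[R]_n | y 0 i < B k 0 i].
      by apply: open_nbhs_nbhs; split => //; exact: open_coord_lt.
    by apply: filterS2 gt lt => y /= -> ->.
  exact: (@filter_forall _ _ _ (nbhs z) _ nbz).
have : cover_compact (cbox a' b).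
  rewrite -compact_cover.
  have -> : cbox a' b = [set v : 'rV[R]_n | forall i, `[a' 0 i, b 0 i]%classic
    (v ord0 i)].
    apply/seteqP; split=> z /=.
      by move=> [az zb] i; rewrite /= in_itv /= az zb.
    by move=> abz; split=> i; have := abz i; rewrite /= in_itv /= => /andP[].
  apply: (@rV_compact R n (fun i => `[a' 0 i, b 0 i]%classic)) => i.
  exact: segment_compact.
move=> /(_ nat setT O (fun k _ => Oopen k))[].
  move=> z [a'z zb].
  have [k _ Az] : (\bigcup_k A k) z.
    by apply: cov => i; rewrite (lt_le_trans _ (a'z i)) ?zb //;
      have /andP[] := a'ab i.
  exists k => // i; move: Az; have [_ ->] := cP k => /(_ i)/andP[-> zc] /=.
  by apply: le_lt_trans zc _; have [] := BP k.
move=> D _ Dcov.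
(* The finite subcover is contained in the initial segment of length [N], whose sum is a partial sum
   of the series. *)
pose N := (\max_(k <- finmap.enum_fset D) k).+1.
have : Delta a' b G <= \sum_(k < N) Delta (c k).1 (B k) G.
  apply: (@Delta_subadd _ _ _ _ _ _ (fun k : 'I_N => (c k).1) (fun k : 'I_N =>
    B k)) => //.
  - by move=> i; have /andP[_ /ltW] := a'ab i.
  - move=> k i; have [/(_ i) /ltW cB _] := BP k; apply: le_trans cB.
    by have [] := cP k.
  move=> z a'bz; have [|k /= kD Oz] := Dcov z.
    by split=> i; have /andP[/ltW] := a'bz i.
  have kN : (k < N)%N by rewrite ltnS; exact: leq_bigmax_seq.
  by exists (Ordinal kN) => // i; have /andP[-> /ltW] := Oz i.
move=> Da'B.
have DB : \sum_(k < N) Delta (c k).1 (B k) G <=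
    \sum_(k < N) (Delta (c k).1 (c k).2 G + eps / 2 / (2 ^ k.+1)%:R).
  by apply: ler_sum => k _; apply: ltW; have [] := BP k.
have {Da'B DB} Dab := le_trans Da'B DB.
apply: (@le_trans _ _ ((Delta a' b G)%:E + (eps / 2)%:E)%E).
  by rewrite -EFinD lee_fin -lerBlDr ltW.
rewrite [eps in leRHS]splitr EFinD addeA leeD2r //.
apply: le_trans (epsilon_trick xpredT (fun k => boxval_ge0 (A k)) (ltW e2)).
move: Dab; rewrite -lee_fin => /le_trans; apply.
rewrite -sumEFin.
have sumE : (\sum_(k < N) (Delta (c k).1 (c k).2 G + eps / 2 / (2 ^
  k.+1)%:R)%:E =
    \sum_(0 <= k < N) (boxval (A k) + (eps / 2 / (2 ^ k.+1)%:R)%:E))%E.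
  rewrite big_mkord; apply: eq_bigr => k _.
  by have [vc ->] := cP k; rewrite boxvalE // EFinD.
rewrite sumE; apply: nneseries_lim_ge => k _ _.
by apply: adde_ge0 => //; rewrite lee_fin ltW.
Qed.

Let mu_box a b : vle a b -> mu (boxoc a b) = (Delta a b G)%:E.
Proof.
move=> ab; apply/eqP; rewrite eq_le; apply/andP; split.
  apply: ereal_inf_lbound; exists (fun k : nat => if k is 0%N return set T then
    boxoc a b else set0).
    by split=> [[|k]|z abz]; [exact: measurable_boxoc|exact: measurable0|exists
      0%N].
  by rewrite nneseries_recl // eseries0 ?adde0 ?boxvalE // => -[|k] // _ _.
by apply: le_ereal_inf_tmp => _ [A [mA /(box_subadditive ab) ?] <-].
Qed.

Let mu_semi_sigma_additive : semi_sigma_additive mu.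
Proof.
move=> F mF tF mUF.
have mF' k : measurable (F k : set (caratheodory_type mu)).
  exact: borel_caratheodory.
apply: (@caratheodory_measure_sigma_additive _ _ mu F mF' tF).
exact: borel_caratheodory.
Qed.

HB.instance Definition _ := isMeasure.Build _ T R mu
  (mu_ext0 boxval0 boxval_ge0) (mu_ext_ge0 boxval_ge0) mu_semi_sigma_additive.

Lemma stieltjes_measure : exists m : {measure set T -> \bar R},
  forall a b, vle a b -> m (boxoc a b) = (Delta a b G)%:E.
Proof. by exists mu; exact: mu_box. Qed.

End Stieltjes.

(** * Groundedness as vanishing on the faces of the orthant *)

Section Vanish.
Variables (R : realType) (n : nat).
Implicit Types (x y z a b : 'rV[R]_n) (f g : 'rV[R]_n -> R).

Definition vanishes_on_axes f := forall x, orthant x ->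
  (exists i, x 0 i = 0) -> f x = 0.

Lemma grounded_vanishes f : rcontinuous f -> grounded f -> vanishes_on_axes f.
Proof.
move=> fc fg x x0 [i xi].
have h1 : f (upd x i t) @[t --> (0 : R)^'+] --> f x.
  have := fc x x0 i; under eq_fun do rewrite upd_shift xi add0r; exact.
have h2 : f (upd x i t) @[t --> (0 : R)^'+] --> (0 : R).
  have := fg x i x0; under eq_fun do under eq_mx do rewrite eq_sym.
  exact.
exact: cvg_unique h1 h2.
Qed.

Lemma vanishes_grounded f : rcontinuous f -> vanishes_on_axes f -> grounded f.
Proof.
move=> fc f0 x i x0.
have ux0 : orthant (upd x i 0) by move=> j; rewrite mxE; case: ifP.
have fu0 : f (upd x i 0) = 0 by apply: f0 => //; exists i; rewrite mxE eqxx.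
have := fc _ ux0 i; rewrite fu0.
apply: cvg_trans; apply: near_eq_cvg; near=> t; congr (f _).
apply/rowP => j; rewrite upd_shift !mxE eqxx add0r.
by case: eqP.
Unshelve. all: by end_near. Qed.

(** Every corner of [0,y] selected by a proper subset [J] has a coordinate 0. *)
Lemma Delta0_vanishes f y : orthant y -> vanishes_on_axes f -> Delta 0 y f = f
  y.
Proof.
move=> y0 f0; rewrite DeltaE (bigD1 [set: 'I_n]%SET) //= big1 ?addr0.
  rewrite cardsT card_ord subnn expr0 mul1r; congr (f _).
  by apply/rowP => i; rewrite mxE inE.
move=> J JT; rewrite f0 ?mulr0 //.
  by move=> i; rewrite !mxE; case: ifP.
have [i iJ] : exists i, i \notin J.
  apply/existsP; apply: contraNT JT; rewrite negb_exists => /forallP JT.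
  by apply/eqP/setP => i; rewrite inE; have := JT i; rewrite negbK.
by exists i; rewrite !mxE (negbTE iJ).
Qed.

End Vanish.

(** * The iterated limits D as masses of closed boxes *)

Section PositiveMeasure.
Variables (R : realType) (n : nat) (g : 'rV[R]_n -> R)
  (m : {measure set (borel_rV R n) -> \bar R}).
Hypothesis mE : forall a b, vle a b ->
  m (boxoc a b) = (Delta (pos a) (pos b) g)%:E.
Implicit Types (x y z a b : 'rV[R]_n).

Let D x y (e : 'I_n + 'I_n -> R) :=
  Delta (\row_i Num.max 0 (x 0 i - e (inl i))) (\row_i (y 0 i + e (inr i))) g.

Let lo x (e : 'I_n + 'I_n -> R) : 'rV[R]_n := \row_i (x 0 i - e (inl i)).
Let hi y (e : 'I_n + 'I_n -> R) : 'rV[R]_n := \row_i (y 0 i + e (inr i)).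

Let lohi x y e : vle x y -> (forall t, 0 <= e t) -> vle (lo x e) (hi y e).
Proof.
move=> xy e0 i; rewrite !mxE; have := xy i; have := e0 (inl i).
by have := e0 (inr i); lra.
Qed.

Let DE x y e : orthant x -> vle x y -> (forall t, 0 <= e t) ->
  (D x y e)%:E = m (boxoc (lo x e) (hi y e)).
Proof.
move=> x0 xy e0; rewrite mE; last exact: lohi.
congr (_%:E); rewrite /D; congr Delta; apply/rowP => i; rewrite !mxE //.
apply/esym/max_idPr; apply: addr_ge0 => //.
exact: le_trans (x0 i) (xy i).
Qed.

Let D_homo x y e e' : orthant x -> vle x y -> (forall t, 0 <= e t) ->
  (forall t, e t <= e' t) -> D x y e <= D x y e'.
Proof.
move=> x0 xy e0 ee'; rewrite -lee_fin !DE //; last first.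
  by move=> t; apply: le_trans (ee' t).
apply: le_measure; rewrite ?inE; [exact: measurable_boxoc..|].
move=> z az i; have /andP[] := az i; rewrite !mxE.
by move: (ee' (inl i)) (ee' (inr i)); lra.
Qed.

(** The increments in D are masses of half-open boxes that shrink to [cbox x y]. They are monotone
    in the margins, so the iterated limit is their infimum; continuity from above along the margins
    1/(k+1) identifies it. *)
Lemma stieltjes_is_D x y : orthant x -> vle x y ->
  exists2 L, is_D x y g L & m (cbox x y) = L%:E.
Proof.
move=> x0 xy.
pose e_ (k : nat) (_ : 'I_n + 'I_n) : R := k.+1%:R^-1.
have e_gt0 k t : 0 < e_ k t by rewrite invr_gt0.
have e_ge0 k t : 0 <= e_ k t by apply: ltW.
pose A k : set (borel_rV R n) := boxoc (lo x (e_ k)) (hi y (e_ k)).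
have e_lt eps : 0 < eps -> forall t, e_ (Num.truncn eps^-1) t < eps.
  by move=> eps0 t; rewrite /e_ invf_plt ?posrE // truncnS_gt.
have e_le k l t : (k <= l)%N -> e_ l t <= e_ k t.
  by move=> kl; rewrite /e_ lef_pV2 ?posrE ?ler_nat.
have sub e : (forall t, 0 < e t) -> cbox x y `<=` boxoc (lo x e) (hi y e).
  move=> e0 z [xz zy] i; rewrite !mxE.
  by move: (xz i) (zy i) (e0 (inl i)) (e0 (inr i)); lra.
have Acap : \bigcap_k A k = cbox x y.
  apply/seteqP; split=> z /=; last first.
    by move=> xzy k _; apply: sub.
  move=> Az; split=> i; apply/ler_addgt0Pr => eps eps0.
    have := Az (Num.truncn eps^-1) I i; rewrite !mxE => /andP[+ _].
    by move: (e_lt _ eps0 (inl i)); lra.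
  have := Az (Num.truncn eps^-1) I i; rewrite !mxE => /andP[_].
  by move: (e_lt _ eps0 (inr i)); lra.
have mA k : measurable (A k) by exact: measurable_boxoc.
have cvgA : m \o A @ \oo --> m (cbox x y).
  rewrite -Acap; apply: nonincreasing_cvg_mu => //.
  - by rewrite -DE // ltry.
  - by apply: bigcap_measurable.
  move=> k l kl; apply/subsetPset => z Az i; have := Az i; rewrite !mxE.
  by move: (e_le _ _ (inl i) kl) (e_le _ _ (inr i) kl); lra.
have mfin : m (cbox x y) \is a fin_num.
  rewrite ge0_fin_numE //; apply: le_lt_trans (ltry (D x y (e_ 0%N))).
  rewrite DE //; apply: le_measure; rewrite ?inE;
    [exact: measurable_cbox|exact: measurable_boxoc|].
  exact: sub.
exists (fine (m (cbox x y))); last by rewrite fineK.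
move=> s sE; apply: (@iterlim_monotone_inf _ _ (fun=> 0) (D x y)).
- by move=> e e' e0 ee'; apply: D_homo.
- by rewrite (perm_uniq sE) enum_uniq.
- by move=> t; rewrite (perm_mem sE) mem_enum.
- move=> e e0; rewrite -lee_fin fineK // DE //; last by move=> t; exact: ltW.
  apply: le_measure; rewrite ?inE; [exact: measurable_cbox|exact:
    measurable_boxoc|].
  exact: sub.
move=> eps eps0.
have cvgD : D x y (e_ k) @[k --> \oo] --> fine (m (cbox x y)).
  have : (D x y (e_ k))%:E @[k --> \oo] --> (fine (m (cbox x y)))%:E.
    by rewrite fineK //; under eq_fun do rewrite DE //.
  by move=> /fine_cvgP[].
have : fine (m (cbox x y)) < fine (m (cbox x y)) + eps by rewrite ltrDl.
move=> /(cvgr_lt _ cvgD) [k _ /(_ k (leqnn k)) Dk].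
by exists (e_ k).
Qed.

End PositiveMeasure.

(** * From monotone functions to inducing signed measures *)

Lemma sube_neq_pinfty (R : realType) (x y : \bar R) : (x < +oo)%E -> (0 <= y)%E
  -> (x - y)%E <> +oo%E.
Proof. by case: x y => [x| |] [y| |] //=. Qed.
Lemma sube_neq_ninfty (R : realType) (x y : \bar R) : (y < +oo)%E -> (0 <= x)%E
  -> (x - y)%E <> -oo%E.
Proof. by case: x y => [x| |] [y| |] //=. Qed.
Lemma sube_defl (R : realType) (x y : \bar R) : (x < +oo)%E -> (0 <= x)%E -> (0
  <= y)%E -> (x +? - y)%E.
Proof. by case: x y => [x| |] [y| |] //=. Qed.
Lemma sube_defr (R : realType) (x y : \bar R) : (y < +oo)%E -> (0 <= x)%E -> (0
  <= y)%E -> (x +? - y)%E.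
Proof. by case: x y => [x| |] [y| |] //=. Qed.

Section MeasureInducing.
Variables (R : realType) (n : nat).
Implicit Types (x y z a b : 'rV[R]_n) (f g h q : 'rV[R]_n -> R).
Local Notation T := (borel_rV R n).

Lemma measure_difference_signed (mu mu' : {measure set T -> \bar R}) :
  (mu setT < +oo)%E \/ (mu' setT < +oo)%E ->
  signed_measure (fun A : set 'rV[R]_n => (mu A - mu' A)%E).
Proof.
move=> fin; split.
- by rewrite !measure0 sube0.
- move=> [[A [mA _] Aoo] [B [mB _] Boo]]; case: fin => fin.
    apply: sube_neq_pinfty Aoo; last exact: measure_ge0.
    by apply: le_lt_trans fin; apply: le_measure; rewrite ?inE.
  apply: sube_neq_ninfty Boo; last exact: measure_ge0.
  by apply: le_lt_trans fin; apply: le_measure; rewrite ?inE.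
move=> F bF tF.
have mF k : measurable (F k : set T) by have [] := bF k.
have mUF : measurable (\bigcup_k F k : set T) by apply: bigcupT_measurable.
have sumE k : (\sum_(0 <= i < k) (mu (F i) - mu' (F i)) =
    \sum_(0 <= i < k) mu (F i) - \sum_(0 <= i < k) mu' (F i))%E.
  elim: k => [|k ih]; first by rewrite !big_geq // sube0.
  rewrite !big_nat_recr //= ih oppeD; first by rewrite addeACA.
  by apply: ge0_adde_def; rewrite inE ?sume_ge0.
under eq_fun do rewrite sumE.
apply: cvgeB; [|exact: measure_semi_sigma_additive..].
have Tfin (m : {measure set T -> \bar R}) : (m setT < +oo -> m (\bigcup_k F k)
  < +oo)%E.
  by apply: le_lt_trans; apply: le_measure; rewrite ?inE.
by case: fin => /Tfin fin; [apply: sube_defl|apply: sube_defr];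
  try exact: measure_ge0.
Qed.

(** The space is exhausted by cubes (-k,k]; clamping moves their lower corner to 0, so their mass is
    the value of [g] at the upper corner. *)
Lemma bounded_stieltjes_fin g (mu : {measure set T -> \bar R}) :
  vanishes_on_axes g -> bounded_on_orthant g ->
  (forall a b, vle a b -> mu (boxoc a b) = (Delta (pos a) (pos b) g)%:E) ->
  (mu setT < +oo)%E.
Proof.
move=> g0 [M gM] muE.
pose A k : set T := boxoc (const_mx (- k%:R)) (const_mx k%:R).
have AT : \bigcup_k A k = setT.
  apply/seteqP; split=> // z _.
  pose K := Num.truncn (\sum_i `|z 0 i|); exists K.+1 => // i; rewrite !mxE.
  have zK : `|z 0 i| < K.+1%:R.
    apply: le_lt_trans (truncnS_gt _); rewrite (bigD1 i) //= lerDl.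
    exact: sumr_ge0.
  by move: zK; rewrite ltr_norml => /andP[-> /ltW].
rewrite -AT; apply: (@le_lt_trans _ _ M%:E); last exact: ltry.
have mA k : measurable (A k) by exact: measurable_boxoc.
have Acvg : mu \o A @ \oo --> mu (\bigcup_k A k).
  apply: nondecreasing_cvg_mu => //; first exact: bigcupT_measurable.
  move=> k l kl; apply/subsetPset => z Az i; have := Az i; rewrite !mxE.
  have : k%:R <= l%:R :> R by rewrite ler_nat.
  by move=> ? /andP[? ?]; apply/andP; split; lra.
rewrite -(cvg_lim _ Acvg) //; apply: lime_le; first by apply: cvgP; exact: Acvg.
apply: nearW => k /=; rewrite muE; last first.
  by move=> i; rewrite !mxE -subr_ge0 opprK addr_ge0.
have -> : pos (const_mx (- k%:R)) = 0 :> 'rV[R]_n.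
  by apply/rowP => i; rewrite !mxE; apply/max_idPl; rewrite oppr_le0.
rewrite Delta0_vanishes //; last exact: orthant_pos.
by rewrite lee_fin; apply: le_trans (gM _ (orthant_pos _)); exact: ler_norm.
Qed.

Lemma exists_stieltjes g : (0 < n)%N -> rcontinuous g -> Delta_monotone g ->
  exists mu : {measure set T -> \bar R},
    forall a b, vle a b -> mu (boxoc a b) = (Delta (pos a) (pos b) g)%:E.
Proof.
move=> n0 gc gm.
have [||mu muE] := @stieltjes_measure R n (g \o @pos R n) n0.
- exact: rc_everywhere_pos.
- move=> x y xy; rewrite Delta_pos; apply: Delta_monotone_ge0 => //.
    exact: orthant_pos.
  exact: vle_pos.
by exists mu => a b ab; rewrite muE // Delta_pos.
Qed.

(** Only the increments of [q] are compared with those of [g] and [h]: f_I itself is not g - h but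
    has the same increments. *)
Lemma measure_inducing_difference q g h : (0 < n)%N ->
  [/\ rcontinuous g, Delta_monotone g & grounded g] ->
  [/\ rcontinuous h, Delta_monotone h & grounded h] ->
  bounded_on_orthant g \/ bounded_on_orthant h ->
  (forall x y, orthant x -> vle x y ->
     Delta x y q = Delta x y g - Delta x y h) ->
  measure_inducing q.
Proof.
move=> n0 [gc gm gg] [hc hm hg] bgh qE.
have [mu muE] := exists_stieltjes n0 gc gm.
have [mu' mu'E] := exists_stieltjes n0 hc hm.
exists (fun A => mu A - mu' A)%E; split.
  apply: measure_difference_signed; case: bgh => b; [left|right].
    exact: bounded_stieltjes_fin (grounded_vanishes gc gg) b muE.
  exact: bounded_stieltjes_fin (grounded_vanishes hc hg) b mu'E.
move=> x y x0 xy.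
have [L LD ->] := stieltjes_is_D muE x0 xy.
have [L' LD' ->] := stieltjes_is_D mu'E x0 xy.
exists (L - L') => //.
move=> s sE; have := iterlimB (LD s sE) (LD' s sE).
apply: eq_iterlim; last by rewrite (perm_uniq sE) enum_uniq.
move=> e e0 _; rewrite qE //.
  by move=> i; rewrite mxE le_max lexx.
have {}e0 t : 0 < e t by apply: e0; rewrite (perm_mem sE) mem_enum.
move=> i; rewrite !mxE ge_max; move: (x0 i) (xy i) (e0 (inl i)) (e0 (inr i)).
by move=> ? ? ? ?; apply/andP; split; lra.
Qed.

End MeasureInducing.

(** * Jordan decomposition of possibly infinite signed measures *)

Lemma npos_adde_def (R : realType) (x y : \bar R) :
  (x <= 0)%E -> (y <= 0)%E -> (x +? y)%E.
Proof. by case: x y => [x| |] [y| |]. Qed.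

Section SignedJordan.
Variables (R : realType) (n : nat).
Local Notation T := (borel_rV R n).
Variables (nu : set T -> \bar R) (F : 'rV[R]_n -> R).
Hypotheses (nu0 : nu set0 = 0%E) (nu_sigma : semi_sigma_additive nu)
  (nu_noty : forall A B, measurable A -> measurable B ->
     nu A = +oo%E -> nu B <> -oo%E)
  (nuF : forall y, orthant y -> nu (cbox 0 y) = (F y)%:E)
  (F0 : vanishes_on_axes F).
Implicit Types (x y z a b : 'rV[R]_n).

Let nuU A B : measurable A -> measurable B -> A `&` B = set0 ->
  nu (A `|` B) = (nu A + nu B)%E.
Proof.
move=> mA mB AB.
have := semi_sigma_additive_is_additive nu0 nu_sigma.
move=> /(semi_additiveW nu0) /(_ A B mA mB); apply => //.
exact: measurableU.
Qed.

Let nuD A B : measurable A -> measurable B -> A `<=` B ->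
  nu B = (nu A + nu (B `\` A))%E.
Proof.
move=> mA mB AB; rewrite -nuU ?setDUK //; first exact: measurableD.
by rewrite setIDA setIC -setIDA setDv setI0.
Qed.

(** An infinite mass of [A] could only be offset by the opposite infinity on the rest of [B], and
    [nu] does not attain both. *)
Let nu_fin A B : measurable A -> measurable B -> A `<=` B ->
  nu B \is a fin_num -> nu A \is a fin_num.
Proof.
move=> mA mB AB; have mBA : measurable (B `\` A) by exact: measurableD.
rewrite (nuD mA mB AB).
have := nu_noty mA mBA; have := nu_noty mBA mA.
case: (nu A) (nu (B `\` A)) => [r| |] [s| |] // h h';
by [have := h' erefl | have := h erefl].
Qed.

Let K (N : nat) : set T := cbox 0 (const_mx N%:R).

Let mK N : measurable (K N). Proof. exact: measurable_cbox. Qed.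

Let K_nd N M : (N <= M)%N -> K N `<=` K M.
Proof.
move=> NM z [z0 zN]; split=> // i; apply: le_trans (zN i) _.
by rewrite !mxE ler_nat.
Qed.

Let nuK_fin N : nu (K N) \is a fin_num.
Proof. by rewrite nuF // => i; rewrite mxE ler0n. Qed.

(** Restricted to a bounded cube, [nu] is finite by [nu_fin], hence a charge to which the Hahn
    decomposition applies. *)
Let c N (A : set T) := nu (A `&` K N).

Let c0 N : c N set0 = 0%E. Proof. by rewrite /c set0I. Qed.

Let c_fin N A : measurable A -> c N A \is a fin_num.
Proof.
by move=> mA; apply: nu_fin (nuK_fin N) => //; exact: measurableI.
Qed.

Let nuI_sigma E : measurable E -> semi_sigma_additive (fun A : set T => nu (A
  `&` E)).
Proof.
move=> mE A mA tA mUA; rewrite setI_bigcupl; apply: nu_sigma.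
- by move=> k; exact: measurableI.
- exact: trivIset_setIr.
- by rewrite -setI_bigcupl; exact: measurableI.
Qed.

Let c_sigma N : semi_sigma_additive (c N).
Proof. exact: nuI_sigma. Qed.

HB.instance Definition _ N := isCharge.Build _ T R (c N)
  (c0 N) (@c_fin N) (@c_sigma N).

Let hahn : {PN : nat -> set T * set T & forall N,
  hahn_decomposition (c N) (PN N).1 (PN N).2}.
Proof.
apply: (@choice _ _ (fun N (PN : set T * set T) =>
  hahn_decomposition (c N) PN.1 PN.2)) => N.
by have [P [Q PQ]] := Hahn_decomposition (c N); exists (P, Q).
Qed.

Let P_ N := (projT1 hahn N).1.

Let mP_ N : measurable (P_ N).
Proof. by have [[]] := projT2 hahn N. Qed.

Let P_pos N A : measurable A -> A `<=` P_ N -> A `<=` K N -> (0 <= nu A)%E.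
Proof.
move=> mA AP AK; have [[_ pos] _ _ _] := projT2 hahn N.
by have : (0 <= c N A)%E := pos A mA AP; rewrite /c (setIidl AK).
Qed.

Let P_neg N A : measurable A -> A `<=` ~` P_ N -> A `<=` K N -> (nu A <= 0)%E.
Proof.
move=> mA AP AK; have [_ [_ neg] PQT _] := projT2 hahn N.
have : A `<=` (projT1 hahn N).2 -> (c N A <= 0)%E := neg A mA.
rewrite /c (setIidl AK); apply => z /AP Pz; have : [set: T] z by [].
by rewrite -PQT => -[].
Qed.

Let S := seqD K.

Let mS N : measurable (S N).
Proof. by case: N => [|N]; rewrite /S /=; [|apply: measurableD]. Qed.

Let S_K N : S N `<=` K N.
Proof. by case: N => [|N] //= z []. Qed.

Let tS : trivIset setT S.
Proof. by apply: trivIset_seqD => N M NM; apply/subsetPset/K_nd. Qed.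

Let orthant_S z : orthant z -> exists N, S N z.
Proof.
move=> z0; suff : (\bigcup_N S N) z by move=> [N _ ?]; exists N.
rewrite eq_bigcup_seqD; exists (Num.truncn (\sum_i z 0 i)).+1 => //.
split=> i; rewrite !mxE //; apply/ltW.
apply: le_lt_trans (truncnS_gt _); rewrite (bigD1 i) //= lerDl.
exact: sumr_ge0.
Qed.

(* nu may be infinite, so the Hahn sets of its restrictions to the shells S N
   are glued together. *)
Let P : set T := \bigcup_N (P_ N `&` S N).

Let mP : measurable P.
Proof. by apply: bigcupT_measurable => N; exact: measurableI. Qed.

Let P_S z N : P z -> S N z -> P_ N z.
Proof.
move=> [M _ [PM SM]] SN; suff <- : M = N by [].
by apply: (tS I I); exists z.
Qed.

Let mO : measurable ([set z | forall i, 0 < z 0 i] : set T).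
Proof. by apply: measurable_forall => i; exact: measurable_coord_gt. Qed.

(** Both parts of [nu] are taken on the open orthant, which contains all the boxes (0,y]. *)
Let O : set T := [set z | forall i, 0 < z 0 i].

Let nu_slices A : measurable A -> A `<=` O ->
  (\sum_(0 <= N < m) nu (A `&` S N))%E @[m --> \oo] --> nu A.
Proof.
move=> mA AO.
have {2}-> : A = \bigcup_N (A `&` S N).
  rewrite -setI_bigcupr; apply/esym/setIidPl => z /AO Oz.
  have [N SN] : exists N, S N z by apply: orthant_S => i; exact: ltW.
  by exists N.
apply: nu_sigma.
- by move=> k; exact: measurableI.
- exact: trivIset_setIl.
- by apply: bigcupT_measurable => k; exact: measurableI.
Qed.

Let PO_pos A : measurable A -> A `<=` P `&` O -> (0 <= nu A)%E.
Proof.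
move=> mA APO; have Acvg : (_ --> nu A) := nu_slices mA (fun z Az => (APO z
  Az).2).
rewrite -(cvg_lim _ Acvg) //; apply: lime_ge; first by apply: cvgP; exact: Acvg.
apply: nearW => m; apply: sume_ge0 => N _; apply: (@P_pos N).
- exact: measurableI.
- by move=> z [/APO[Pz _] Sz]; exact: P_S.
- by move=> z [_ /S_K].
Qed.

Let NO_neg A : measurable A -> A `<=` ~` P `&` O -> (nu A <= 0)%E.
Proof.
move=> mA APO; have Acvg : (_ --> nu A) := nu_slices mA (fun z Az => (APO z
  Az).2).
rewrite -(cvg_lim _ Acvg) //; apply: lime_le; first by apply: cvgP; exact: Acvg.
apply: nearW => m; apply: sume_le0 => N _; apply: (@P_neg N).
- exact: measurableI.
- by move=> z [/APO[Pz _] Sz] PN; apply: Pz; exists N.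
- by move=> z [_ /S_K].
Qed.

(** A measure has to be non-negative on every set, also where [nu] is uncontrolled; on measurable
    sets the maximum changes nothing. *)
Let mp A := maxe 0%E (nu (A `&` (P `&` O))).

Let mpE A : measurable A -> mp A = nu (A `&` (P `&` O)).
Proof.
move=> mA; apply/max_idPr; apply: PO_pos; last by move=> z [].
by apply: measurableI => //; exact: measurableI.
Qed.

Let mp0 : mp set0 = 0%E. Proof. by rewrite mpE // set0I. Qed.

Let mp_ge0 A : (0 <= mp A)%E. Proof. by rewrite le_max lexx. Qed.

Let mp_sigma : semi_sigma_additive mp.
Proof.
move=> A mA tA mUA; rewrite mpE //.
under eq_fun do under eq_bigr do rewrite mpE //.
by apply: nuI_sigma => //; apply: measurableI.
Qed.

HB.instance Definition _ := isMeasure.Build _ T R mp mp0 mp_ge0 mp_sigma.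

Let mm A := maxe 0%E (- nu (A `&` (~` P `&` O)))%E.

Let mPC : measurable (~` P `&` O).
Proof. by apply: measurableI => //; exact: measurableC. Qed.

Let nuPC_le0 A : measurable A -> (nu (A `&` (~` P `&` O)) <= 0)%E.
Proof. by move=> mA; apply: NO_neg => [|z []//]; exact: measurableI. Qed.

Let mmE A : measurable A -> mm A = (- nu (A `&` (~` P `&` O)))%E.
Proof. by move=> mA; apply/max_idPr; rewrite oppe_ge0 nuPC_le0. Qed.

Let mm0 : mm set0 = 0%E. Proof. by rewrite mmE // set0I nu0 oppe0. Qed.

Let mm_ge0 A : (0 <= mm A)%E. Proof. by rewrite le_max lexx. Qed.

Let mm_sigma : semi_sigma_additive mm.
Proof.
move=> A mA tA mUA; rewrite mmE //.
have sumE m : (\sum_(0 <= i < m) mm (A i) =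
    - \sum_(0 <= i < m) nu (A i `&` (~` P `&` O)))%E.
  elim: m => [|m ih]; first by rewrite !big_geq // oppe0.
  rewrite !big_nat_recr //= ih mmE // oppeD //.
  by apply: npos_adde_def; [apply: sume_le0 => i _|]; exact: nuPC_le0.
under eq_fun do rewrite sumE.
by apply: cvgeN; apply: nuI_sigma.
Qed.

HB.instance Definition _ := isMeasure.Build _ T R mm mm0 mm_ge0 mm_sigma.

(** Interpolates between [0,y], for empty [s], and (0,y], for [s] listing all coordinates, by
    removing one face at a time. *)
Let E (s : seq 'I_n) y : set T :=
  [set z | forall i, 0 <= z 0 i <= y 0 i /\ (i \in s -> 0 < z 0 i)].

Let mE s y : measurable (E s y).
Proof.
apply: (@measurable_forall _ _ (fun i => [set z : T | 0 <= z 0 i <= y 0 i /\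
  (i \in s -> 0 < z 0 i)])) => i.
have <- : [set z : T | 0 <= z 0 i] `&` [set z : T | z 0 i <= y 0 i] `&`
   (if i \in s then [set z : T | 0 < z 0 i] else setT) =
   [set z : T | 0 <= z 0 i <= y 0 i /\ (i \in s -> 0 < z 0 i)].
  apply/seteqP; split=> z /=.
    by move=> [[-> ->]]; case: ifP.
  by move=> [/andP[-> ->]]; case: ifP => _ h; split => //; exact: h.
apply: measurableI; last first.
  by case: ifP => _; [exact: measurable_coord_gt|exact: measurableT].
by apply: measurableI; [exact: measurable_coord_ge|exact: measurable_coord_le].
Qed.

(* Removing the face [z_i = 0] removes a set of the same shape with upper
   corner y[i := 0], whose mass vanishes. *)
Let nuE s y : orthant y -> nu (E s y) = (F y)%:E.
Proof.
elim: s y => [|i s ih] y y0.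
  rewrite -nuF //; congr nu; apply/seteqP; split=> z /=.
    by move=> zy; split=> i; have [/andP[]] := zy i => //; rewrite mxE.
  by move=> [z0 zy] i; split => //; rewrite zy andbT; have := z0 i; rewrite mxE.
have uy0 : orthant (upd y i 0) by move=> j; rewrite mxE; case: ifP.
have Fu0 : F (upd y i 0) = 0 by apply: F0 => //; exists i; rewrite mxE eqxx.
have [si|si] := boolP (i \in s).
  rewrite -ih //; congr nu; apply/seteqP; split=> z /= zy j;
    have [zj zs] := zy j.
    by split=> // js; apply: zs; rewrite inE js orbT.
  by split=> //; rewrite inE => /orP[/eqP ->|//]; have [_] := zy i; exact.
rewrite -(ih y) //.
have -> : E s y = E (i :: s) y `|` E s (upd y i 0).
  apply/seteqP; split=> z /=.
    move=> zy; have [zi|zi] := ltP 0 (z 0 i); [left|right] => j;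
      have [zj zs] := zy j.
      by split=> //; rewrite inE => /orP[/eqP ->//|].
    split=> //; rewrite mxE; case: eqP => // ->.
    by have [/andP[-> _] _] := zy i.
  move=> [zy|zy] j; have [zj zs] := zy j.
    by split=> // js; apply: zs; rewrite inE js orbT.
  split=> //; move: zj; rewrite mxE; case: eqP => [-> /andP[-> /le_trans]|//].
  exact.
rewrite nuU //.
  by rewrite (ih (upd y i 0)) // Fu0 adde0.
apply/seteqP; split=> // z /= [/(_ i)[_]].
rewrite mem_head => /(_ isT) z0 /(_ i)[]; rewrite mxE eqxx => /andP[_].
by rewrite leNgt z0.
Qed.

Lemma signed_measure_jordan : exists (mp mm : {measure set T -> \bar R}) (P :
  set T),
  [/\ measurable P, mp (~` P) = 0%E, mm P = 0%E,
     (mp setT < +oo)%E \/ (mm setT < +oo)%E &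
     forall y, orthant y -> [/\ (mp (boxoc 0 y) < +oo)%E,
       (mm (boxoc 0 y) < +oo)%E &
       F y = fine (mp (boxoc 0 y)) - fine (mm (boxoc 0 y))]].
Proof.
exists mp, mm, P; split => //.
- change (mp (~` P) = 0%E); rewrite mpE; last exact: measurableC.
  by rewrite setIA setICl set0I.
- by change (mm P = 0%E); rewrite mmE // setIA setICr set0I nu0 oppe0.
- change ((mp setT < +oo)%E \/ (mm setT < +oo)%E).
  rewrite mpE // mmE // !setTI; have := @nu_noty (P `&` O) (~` P `&` O).
  case: (nu (P `&` O)) => [r| |]; [by left; rewrite ltry| |by left].
  case: (nu (~` P `&` O)) => [r| |]; [by right; rewrite ltry|by right|].
  by move=> /(_ (measurableI _ _ mP mO) mPC erefl) /(_ erefl).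
move=> y y0.
have mB : measurable (boxoc 0 y : set T) by exact: measurable_boxoc.
have BE : boxoc 0 y = E (enum 'I_n) y.
  apply/seteqP; split=> z /= zy i; have := zy i; rewrite mxE.
    by move=> /andP[z0 ->]; rewrite (ltW z0).
  by move=> [/andP[_ ->]]; rewrite mem_enum => /(_ isT) ->.
have BO : boxoc 0 y `<=` O by move=> z /= zy i; have := zy i;
  rewrite mxE => /andP[].
have nuB : nu (boxoc 0 y) = (F y)%:E by rewrite BE nuE.
have fin (A : set T) : measurable A -> A `<=` boxoc 0 y -> nu A \is a fin_num.
  by move=> mA AB; apply: (@nu_fin _ (boxoc 0 y)) => //; rewrite nuB.
have nuBE : nu (boxoc 0 y) = (nu (boxoc 0 y `&` (P `&` O)) +
   nu (boxoc 0 y `&` (~` P `&` O)))%E.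
  rewrite -nuU; [|by apply: measurableI => //;
    exact: measurableI|exact: measurableI|].
    by rewrite -setIUr -setIUl setUCr setTI (setIidl BO).
  by rewrite setIACA [P `&` O `&` _]setIACA setICr set0I setI0.
have fP := fin _ (measurableI _ _ mB (measurableI _ _ mP mO)) (fun z Az =>
  Az.1).
have fQ := fin _ (measurableI _ _ mB mPC) (fun z Az => Az.1).
change ([/\ (mp (boxoc 0 y) < +oo)%E, (mm (boxoc 0 y) < +oo)%E &
  F y = fine (mp (boxoc 0 y)) - fine (mm (boxoc 0 y))]).
split.
- by rewrite mpE // -ge0_fin_numE // -mpE.
- by rewrite mmE // -ge0_fin_numE ?fin_numN // -mmE.
rewrite mpE // mmE // fineN opprK -fineD // -nuBE nuB //.
Qed.

End SignedJordan.

(** * Distribution functions of measures on boxes *)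

Section DistributionFunction.
Variables (R : realType) (n : nat) (m : {measure set (borel_rV R n) -> \bar R}).
Hypothesis m_fin : forall y, orthant y -> (m (boxoc 0 y) < +oo)%E.
Implicit Types (x y z a b : 'rV[R]_n).
Local Notation T := (borel_rV R n).

Definition boxcdf y : R := fine (m (boxoc 0 y)).

Lemma boxoc_fin x y : orthant x -> orthant y -> m (boxoc x y) \is a fin_num.
Proof.
move=> x0 y0; rewrite ge0_fin_numE //; apply: le_lt_trans (m_fin y0).
apply: le_measure; rewrite ?inE; [exact: measurable_boxoc..|].
move=> z xz i; rewrite mxE; have /andP[zx ->] := xz i.
by rewrite (le_lt_trans (x0 i) zx).
Qed.

Lemma orthant0 : orthant (0 : 'rV[R]_n).
Proof. by move=> i; rewrite mxE. Qed.

Lemma boxcdf_ge0 y : 0 <= boxcdf y.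
Proof. exact: fine_ge0. Qed.

Lemma boxcdf_vanishes : vanishes_on_axes boxcdf.
Proof.
move=> y y0 [i yi]; rewrite /boxcdf (_ : boxoc 0 y = set0) ?measure0 //.
apply/seteqP; split=> // z /(_ i); rewrite yi mxE => /andP[z0].
by rewrite leNgt z0.
Qed.

(** Corners of the box whose mass is a partial difference: coordinates in [s] run through the added
    slab (x_i, x_i + eps_i], the others through (0, x_i]. *)
Let lo (s : seq 'I_n) x : 'rV[R]_n := \row_i (if i \in s then x 0 i else 0).
Let hi (s : seq 'I_n) eps x : 'rV[R]_n :=
  \row_i (if i \in s then x 0 i + eps i else x 0 i).

Let loE s x i : lo s x 0 i = if i \in s then x 0 i else 0.
Proof. by rewrite mxE. Qed.
Let hiE s eps x i : hi s eps x 0 i = if i \in s then x 0 i + eps i else x 0 i.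
Proof. by rewrite mxE. Qed.

(** A difference in a new direction [i] removes from the longer box its part with z_i <= x_i.
    Arbitrary lists [s] yield the monotonicity of every order k at once. *)
Lemma pdiffs_boxcdf s eps x : uniq s -> (forall i, 0 <= eps i) -> orthant x ->
  pdiffs s eps boxcdf x = fine (m (boxoc (lo s x) (hi s eps x))).
Proof.
move=> us e0; elim: s us x => [_ x x0|i s ih /= /andP[nis us] x x0].
  by congr (fine (m (boxoc _ _))); apply/rowP => i; rewrite !mxE.
pose x' := x + eps i *: unitv R i.
have x'0 : orthant x'.
  by move=> j; rewrite shiftE; case: eqP => // <-; apply: addr_ge0.
rewrite /pdiff !ih // -/x'.
have lo0 r z : orthant z -> orthant (lo r z).
  by move=> z0 j; rewrite mxE; case: ifP.
have hi0 r z : orthant z -> orthant (hi r eps z).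
  by move=> z0 j; rewrite mxE; case: ifP => // _; apply: addr_ge0.
have -> : boxoc (lo s x') (hi s eps x') =
    boxoc (lo s x) (hi s eps x) `|` boxoc (lo (i :: s) x) (hi (i :: s) eps x).
  apply/seteqP; split=> z.
    move=> xz; have zi : 0 < z 0 i <= x 0 i + eps i.
      by have := xz i; rewrite loE hiE (negbTE nis) shiftE eqxx.
    have zj j : j != i -> lo s x 0 j < z 0 j <= hi s eps x 0 j.
      by move=> ji; have := xz j; rewrite !loE !hiE !shiftE eq_sym (negbTE ji).
    have [zx|xz'] := leP (z 0 i) (x 0 i); [left|right] => j.
      have [->|] := eqVneq j i; last exact: zj.
      by rewrite loE hiE (negbTE nis) zx; have /andP[->] := zi.
    have [->|ji] := eqVneq j i; last first.
      by have := zj _ ji; rewrite !loE !hiE inE (negbTE ji).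
    by rewrite loE hiE mem_head xz'; have /andP[_ ->] := zi.
  move=> [xz|xz] j; have := xz j; rewrite !loE !hiE ?inE !shiftE.
    have [<-|_] := eqVneq i j; last by [].
    by rewrite (negbTE nis) => /andP[-> /le_trans]; apply; rewrite lerDl.
  rewrite eq_sym; have [<-|_] := eqVneq i j => //=; rewrite (negbTE nis).
  by move=> /andP[/(le_lt_trans (x0 _)) -> ->].
rewrite measureU; [|exact: measurable_boxoc..|].
  rewrite fineD; [|by apply: boxoc_fin; [exact: lo0|exact: hi0]..].
  by rewrite [X in X - _]addrC addrK.
apply/seteqP; split=> // z [h1 h2]; have := h1 i; have := h2 i.
rewrite !loE !hiE mem_head (negbTE nis) => /andP[xz _] /andP[_].
by rewrite leNgt xz.
Qed.

Lemma Delta_boxcdf x y : orthant x -> vle x y ->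
  Delta x y boxcdf = fine (m (boxoc x y)).
Proof.
move=> x0 xy; rewrite /Delta pdiffs_boxcdf ?enum_uniq //; last first.
  by move=> i; rewrite subr_ge0.
congr (fine (m (boxoc _ _))); apply/rowP => i; rewrite !mxE mem_enum //.
by rewrite addrC subrK.
Qed.

Lemma Delta_boxcdf_ge0 x y : orthant x -> vle x y -> 0 <= Delta x y boxcdf.
Proof. by move=> x0 xy; rewrite Delta_boxcdf // fine_ge0. Qed.

Lemma Delta_monotone_boxcdf : Delta_monotone boxcdf.
Proof.
move=> k _ s us eps e0 x x0; rewrite pdiffs_boxcdf ?fine_ge0 // => i.
exact: ltW.
Qed.

Lemma le_boxcdf x y : orthant x -> vle x y -> boxcdf x <= boxcdf y.
Proof.
move=> x0 xy; have y0 i : 0 <= y 0 i by apply: le_trans (xy i).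
rewrite fine_le ?boxoc_fin //; [exact: orthant0..|].
apply: le_measure; rewrite ?inE; [exact: measurable_boxoc..|].
by move=> z xz i; have /andP[-> /le_trans->] := xz i.
Qed.

(** Continuity of the measure from above gives the limit along the steps 1/(k+1); monotonicity
    extends it to all small steps. *)
Lemma rcontinuous_boxcdf : rcontinuous boxcdf.
Proof.
move=> x x0 i.
have xt0 t : 0 <= t -> orthant (x + t *: unitv R i).
  by move=> t0 j; rewrite shiftE; case: ifP => // _; apply: addr_ge0.
pose A k : set T := boxoc 0 (x + k.+1%:R^-1 *: unitv R i).
have mA k : measurable (A k) by exact: measurable_boxoc.
have Acap : \bigcap_k A k = boxoc 0 x.
  apply/seteqP; split=> z /= zx; last first.
    move=> k _ j; rewrite shiftE; have /andP[-> zj] := zx j.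
    by case: ifP => // _; rewrite (le_trans zj) // lerDl.
  move=> j; have := zx 0%N I j => /andP[-> _] /=.
  apply/ler_addgt0Pr => eps eps0.
  have /andP[_] := zx (Num.truncn eps^-1) I j; rewrite shiftE.
  case: ifP => _ /le_trans; apply; last by rewrite lerDl ltW.
  by rewrite lerD2l ltW // invf_plt ?posrE // truncnS_gt.
have Acvg : boxcdf (x + k.+1%:R^-1 *: unitv R i) @[k --> \oo] --> boxcdf x.
  have : m \o A @ \oo --> m (boxoc 0 x).
    rewrite -Acap; apply: nonincreasing_cvg_mu => //.
    - by apply: m_fin; apply: xt0.
    - by rewrite Acap; exact: measurable_boxoc.
    move=> k l kl; apply/subsetPset => z Az j; have /andP[-> /=] := Az j.
    rewrite !shiftE; case: ifP => // _ /le_trans; apply.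
    by rewrite lerD2l lef_pV2 ?posrE ?ler_nat.
  rewrite -[m (boxoc 0 x)]fineK ?boxoc_fin //; last exact: orthant0.
  by move=> /fine_cvgP[].
apply/cvgrPdist_le => eps eps0.
have : boxcdf x < boxcdf x + eps by rewrite ltrDl.
move=> /(cvgr_lt _ Acvg) [k _ /(_ k (leqnn k)) /= xk].
near=> t; have t0 : 0 < t by near: t; exact: nbhs_right_gt.
have xxt : boxcdf x <= boxcdf (x + t *: unitv R i).
  by apply: le_boxcdf => // j; rewrite shiftE; case: ifP => // _;
    rewrite lerDl ltW.
rewrite distrC ger0_norm ?subr_ge0 // lerBlDl; apply: le_trans (ltW xk).
apply: le_boxcdf => [|j]; first exact/xt0/ltW.
rewrite !shiftE; case: ifP => // _; rewrite lerD2l.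
by near: t; apply: nbhs_right_le; rewrite invr_gt0.
Unshelve. all: by end_near. Qed.

Lemma bounded_boxcdf : (m setT < +oo)%E -> bounded_on_orthant boxcdf.
Proof.
move=> mT; exists (fine (m setT)) => x x0; rewrite ger0_norm ?boxcdf_ge0 //.
rewrite fine_le ?boxoc_fin //; first exact: orthant0.
  by rewrite ge0_fin_numE.
by apply: le_measure; rewrite ?inE //; exact: measurable_boxoc.
Qed.

End DistributionFunction.

(** * Vitali variation *)

Section Vitali.
Variables (R : realType) (n : nat).
Implicit Types (x y z a b : 'rV[R]_n) (f g h : 'rV[R]_n -> R).

Lemma itv_partition_nth_lt (a b : R) s (j : 'I_(size s)) :
  itv_partition a b s -> nth 0 (a :: s) j < nth 0 s j.
Proof. by move=> [/(pathP 0)/(_ j (ltn_ord j)) + _]. Qed.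

Lemma vle_cell a b s (k : {dffun forall i : 'I_n, 'I_(size (s i))}) :
  (forall i, itv_partition (a 0 i) (b 0 i) (s i)) -> vle (glo a k) (ghi k).
Proof. by move=> sP i; rewrite !mxE; apply/ltW/itv_partition_nth_lt/sP. Qed.

Lemma vle_glo a b s (k : {dffun forall i : 'I_n, 'I_(size (s i))}) :
  (forall i, itv_partition (a 0 i) (b 0 i) (s i)) -> vle a (glo a k).
Proof.
move=> sP i; have ki := ltn_ord (k i); have ki' := ltnW ki.
by rewrite !mxE (set_nth_default (b 0 i)) //;
  apply: itv_partition_nth_ge (sP i).
Qed.

Lemma vle_ghi a b s (k : {dffun forall i : 'I_n, 'I_(size (s i))}) :
  (forall i, itv_partition (a 0 i) (b 0 i) (s i)) -> vle (ghi k) b.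
Proof.
move=> sP i; have ki := ltn_ord (k i).
rewrite !mxE -[nth _ (s i) _]/(nth 0 (a 0 i :: s i) (k i).+1).
by rewrite (set_nth_default (b 0 i)) //; apply: itv_partition_nth_le (sP i).
Qed.

Lemma orthant_glo y s (k : {dffun forall i : 'I_n, 'I_(size (s i))}) :
  (forall i, itv_partition ((0 : 'rV[R]_n) 0 i) (y 0 i) (s i)) ->
  orthant (glo 0 k).
Proof. by move=> /(vle_glo k)/vle0. Qed.

Lemma exists_partition y : orthant y -> exists s : 'I_n -> seq R,
  forall i, itv_partition ((0 : 'rV[R]_n) 0 i) (y 0 i) (s i).
Proof.
(* A side of length 0 admits the empty list of partition points only. *)
move=> y0; exists (fun i => if y 0 i == 0 then [::] else [:: y 0 i]) => i.
rewrite mxE; case: eqP => [->|/eqP yi]; first by split.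
by apply: itv_partition1; rewrite lt_neqAle eq_sym yi y0.
Qed.

(** A partition must be exhibited, because the supremum of the empty set would be -oo. *)
Lemma vitali_variation_ge0 y f : orthant y -> (0 <= vitali_variation 0 y f)%E.
Proof.
move=> /exists_partition[s sP].
apply: (@le_trans _ _ (grid_variation 0 y f s)%:E).
  by rewrite lee_fin; apply: sumr_ge0.
by apply: ereal_sup_ubound; exists s.
Qed.

Lemma vitali_variation_monotone g y : orthant y -> vanishes_on_axes g ->
  (forall x y, orthant x -> vle x y -> 0 <= Delta x y g) ->
  vitali_variation 0 y g = (g y)%:E.
Proof.
move=> y0 g0 gm.
have gridE s : (forall i, itv_partition ((0 : 'rV[R]_n) 0 i) (y 0 i) (s i)) ->
    grid_variation 0 y g s = g y.
  move=> sP; rewrite -(Delta0_vanishes y0 g0) -(grid_telescope _ sP).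
  apply: eq_bigr => k _; rewrite ger0_norm //; apply: gm;
    [exact: orthant_glo sP|exact: vle_cell sP].
apply/eqP; rewrite eq_le; apply/andP; split.
  by apply: ge_ereal_sup => _ [s sP ->]; rewrite gridE.
have [s sP] := exists_partition y0.
by apply: ereal_sup_ubound; exists s => //; rewrite gridE.
Qed.

Lemma vitali_variation_le f g h y : orthant y ->
  vanishes_on_axes g -> vanishes_on_axes h ->
  (forall x y, orthant x -> vle x y -> 0 <= Delta x y g) ->
  (forall x y, orthant x -> vle x y -> 0 <= Delta x y h) ->
  (forall x, orthant x -> f x = g x - h x) ->
  (vitali_variation 0 y f <= (g y + h y)%:E)%E.
Proof.
move=> y0 g0 h0 gm hm fE; apply: ge_ereal_sup => _ [s sP ->]; rewrite lee_fin.
rewrite -(Delta0_vanishes y0 g0) -(Delta0_vanishes y0 h0).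
rewrite -!(grid_telescope _ sP) -big_split /=; apply: ler_sum => k _.
have c0 := orthant_glo k sP; have lohi := vle_cell k sP.
rewrite (_ : Delta _ _ f = Delta (glo 0 k) (ghi k) g - Delta (glo 0 k) (ghi k)
  h).
  apply: le_trans (ler_normB _ _) _.
  by rewrite !ger0_norm //; [exact: hm|exact: gm].
rewrite -DeltaB; apply: eq_Delta => // z cz _; apply: fE.
by apply/vle0; apply: vle_trans cz; apply/vle0.
Qed.

End Vitali.

(** * Dyadic grids and approximation of Borel sets by unions of cells *)

Lemma measure_finType_bigcup d (T : measurableType d) (R : realType)
    (m : {measure set T -> \bar R}) (J : finType) (F : J -> set T) :
  (forall j, measurable (F j)) -> trivIset setT F ->
  m (\bigcup_j F j) = (\sum_j m (F j))%E.
Proof.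
move=> mF tF; have JE : [set: J] = [set` index_enum J].
  by apply/seteqP; split=> j //= _; rewrite mem_index_enum.
rewrite measure_fin_bigcup //; last exact: finite_finset.
by rewrite [in LHS]JE -fsbig_seq // index_enum_uniq.
Qed.

Section Dyadic.
Variables (R : realType) (n : nat) (y : 'rV[R]_n).
Hypothesis y_gt0 : forall i, 0 < y 0 i.
Implicit Types (x z a b : 'rV[R]_n) (M : nat) (U A : set (borel_rV R n)).
Local Notation T := (borel_rV R n).

Definition dyadic_pt M i (j : nat) : R := y 0 i * j%:R / (2 ^ M)%:R.

Definition dyadic M (i : 'I_n) := mkseq (fun j => dyadic_pt M i j.+1) (2 ^ M).

Local Notation idx M := {dffun forall i : 'I_n, 'I_(size (dyadic M i))}.
Local Notation K := (boxoc 0 y).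

Let pow_gt0 M : 0 < (2 ^ M)%:R :> R. Proof. by rewrite ltr0n expn_gt0. Qed.

Lemma le_dyadic_pt M i j k : (dyadic_pt M i j <= dyadic_pt M i k) = (j <= k)%N.
Proof. by rewrite ler_pM2r ?invr_gt0 // ler_pM2l // ler_nat. Qed.

Lemma lt_dyadic_pt M i j k : (dyadic_pt M i j < dyadic_pt M i k) = (j < k)%N.
Proof. by rewrite ltNge le_dyadic_pt -ltnNge. Qed.

Lemma dyadic_pt0 M i : dyadic_pt M i 0 = 0.
Proof. by rewrite /dyadic_pt mulr0 mul0r. Qed.

Lemma dyadic_pt_last M i : dyadic_pt M i (2 ^ M) = y 0 i.
Proof. by rewrite /dyadic_pt mulfK // gt_eqF. Qed.

Lemma nth_dyadic M i j : (j < 2 ^ M)%N -> nth 0 (dyadic M i) j = dyadic_pt M i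
  j.+1.
Proof. exact: nth_mkseq. Qed.

Lemma nth_dyadic0 M i j : (j < (2 ^ M).+1)%N ->
  nth 0 (0 :: dyadic M i) j = dyadic_pt M i j.
Proof. by case: j => [|j] /= jM; rewrite ?dyadic_pt0 // nth_dyadic. Qed.

Lemma size_dyadic M i : size (dyadic M i) = (2 ^ M)%N.
Proof. exact: size_mkseq. Qed.

Lemma dyadicP M i : itv_partition ((0 : 'rV[R]_n) 0 i) (y 0 i) (dyadic M i).
Proof.
rewrite mxE; split.
  apply/(pathP 0) => j; rewrite size_dyadic => jM.
  by rewrite nth_dyadic0 ?nth_dyadic ?lt_dyadic_pt // ltnW.
by rewrite (last_nth 0) size_dyadic nth_dyadic0 // dyadic_pt_last.
Qed.

(** Inside (0,y] this means lying in the same cell. Stated by comparisons with grid points it is an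
    equivalence on all vectors, and refinement of the grid is immediate. *)
Definition sim M z z' :=
  forall i j, (z 0 i <= dyadic_pt M i j) = (z' 0 i <= dyadic_pt M i j).

Lemma sim_refl M z : sim M z z. Proof. by []. Qed.
Lemma sim_sym M z z' : sim M z z' -> sim M z' z. Proof. by move=> zz' i j. Qed.
Lemma sim_trans M z2 z1 z3 : sim M z1 z2 -> sim M z2 z3 -> sim M z1 z3.
Proof. by move=> z12 z23 i j; rewrite z12. Qed.

Lemma sim_le M N z z' : (M <= N)%N -> sim N z z' -> sim M z z'.
Proof.
move=> MN zz' i j.
have -> : dyadic_pt M i j = dyadic_pt N i (j * 2 ^ (N - M)); last exact: zz'.
rewrite /dyadic_pt -{2}(subnKC MN) expnD !natrM.
by field; rewrite !gt_eqF.
Qed.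

Definition cell M (k : idx M) : set T := boxoc (glo 0 k) (ghi k).

Let idx_lt M (k : idx M) i : (k i < 2 ^ M)%N.
Proof. by rewrite -(size_dyadic M i). Qed.

Lemma cellP M (k : idx M) z : cell k z <->
  forall i, dyadic_pt M i (k i) < z 0 i <= dyadic_pt M i (k i).+1.
Proof.
have kE i : (glo 0 k 0 i = dyadic_pt M i (k i)) * (ghi k 0 i = dyadic_pt M i (k
  i).+1).
  have ki := idx_lt k i; have ki' := ltnW ki.
  by rewrite !mxE nth_dyadic ?nth_dyadic0.
by split=> kz i; have := kz i; rewrite !kE.
Qed.

Lemma cell_le M (k : idx M) z i j : cell k z ->
  (z 0 i <= dyadic_pt M i j) = (k i < j)%N.
Proof.
move=> /cellP /(_ i) /andP[kz zk]; apply/idP/idP => [zj|kj].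
  by rewrite -(lt_dyadic_pt M i); apply: lt_le_trans zj.
by apply: le_trans zk _; rewrite le_dyadic_pt.
Qed.

Lemma sim_cell M (k : idx M) z z' : cell k z -> cell k z' -> sim M z z'.
Proof. by move=> kz kz' i j; rewrite !(cell_le _ _ (k := k)). Qed.

Lemma cell_inj M (k k' : idx M) z : cell k z -> cell k' z -> k = k'.
Proof.
move=> kz kz'; apply/ffunP => i; apply/val_inj/eqP => /=.
have kk' j : (k i < j)%N = (k' i < j)%N.
  by rewrite -!(cell_le i j kz) -(cell_le i j kz').
by rewrite eqn_leq -ltnS kk' leqnn -ltnS -kk' leqnn.
Qed.

Lemma cell_exists M z : K z -> exists k : idx M, cell k z.
Proof.
move=> Kz.
(* Cell [j] ends at grid point [j.+1], so the least such [j] is the index of the cell containing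
   [z 0 i]. *)
have ex i : exists j, z 0 i <= dyadic_pt M i j.+1.
  exists (2 ^ M).-1; rewrite prednK ?expn_gt0 // dyadic_pt_last.
  by have /andP[] := Kz i.
have jlt i : (ex_minn (ex i) < size (dyadic M i))%N.
  case: ex_minnP => j _ jmin; rewrite size_dyadic -(prednK (expn_gt0 2 M)) ltnS.
  apply: jmin; rewrite prednK ?expn_gt0 // dyadic_pt_last.
  by have /andP[] := Kz i.
exists [ffun i => Ordinal (jlt i)]; apply/cellP => i; rewrite ffunE /=.
case: ex_minnP => j -> jmin; rewrite andbT ltNge; apply/negP.
case: j jmin => [|j] jmin; first by rewrite dyadic_pt0 leNgt; have := Kz i;
  rewrite mxE => /andP[->].
by move=> /jmin; rewrite ltnn.
Qed.

Lemma cell_sub M (k : idx M) : cell k `<=` K.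
Proof.
move=> z kz i; have /andP[kz1 kz2] := kz i.
rewrite (le_lt_trans (vle_glo k (dyadicP M) i) kz1).
by rewrite (le_trans kz2 (vle_ghi k (dyadicP M) i)).
Qed.

Lemma measurable_cell M (k : idx M) : measurable (cell k).
Proof. exact: measurable_boxoc. Qed.

Lemma cell_ghi M (k : idx M) : cell k (ghi k).
Proof.
move=> i; rewrite lexx andbT !mxE.
by have := itv_partition_nth_lt (k i) (dyadicP M i); rewrite mxE.
Qed.

(** Within (0,y] these are the unions of cells of level M; as invariance under [sim], the notion is
    clearly stable under complements and unions. *)
Definition saturated M U := forall z z', sim M z z' -> U z -> U z'.

Lemma saturatedC M U : saturated M U -> saturated M (~` U).
Proof. by move=> sU z z' /sim_sym zz' Uz /(sU _ _ zz'). Qed.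

Lemma saturatedU M U U' : saturated M U -> saturated M U' -> saturated M (U `|`
  U').
Proof.
by move=> sU sU' z z' zz' [/(sU _ _ zz')|/(sU' _ _ zz')]; [left|right].
Qed.

Lemma saturated_le M N U : (M <= N)%N -> saturated M U -> saturated N U.
Proof. by move=> MN sU z z' /(sim_le MN); exact: sU. Qed.

(** The upper corner belongs to its half-open cell, so for saturated [U] it decides whether the
    whole cell lies in [U]. *)
Let scell M U (k : idx M) := if `[< U (ghi k) >] then cell k else set0.

Let saturatedE M U : saturated M U -> U `&` K = \bigcup_(k : idx M) scell U k.
Proof.
move=> sU; apply/seteqP; split=> [z [Uz Kz]|z [k _]].
  have [k kz] := cell_exists M Kz; exists k => //; rewrite /scell asboolT //.
  by apply: sU Uz; apply: sim_cell kz _; exact: cell_ghi.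
rewrite /scell; case: asboolP => // Uk kz; split; last exact: cell_sub kz.
by apply: sU Uk; apply: sim_cell kz; exact: cell_ghi.
Qed.

Let measurable_scell M U (k : idx M) : measurable (scell U k).
Proof. by rewrite /scell; case: asboolP => _ //; exact: measurable_cell. Qed.

Lemma measurable_saturated M U : saturated M U -> measurable (U `&` K).
Proof.
move=> /saturatedE ->; apply: fin_bigcup_measurable; first exact: finite_finset.
by move=> k _; exact: measurable_scell.
Qed.

Lemma measure_saturated (m : {measure set T -> \bar R}) M U : saturated M U ->
  m (U `&` K) = (\sum_(k : idx M | `[< U (ghi k) >]) m (cell k))%E.
Proof.
move=> /saturatedE ->; rewrite measure_finType_bigcup //.
  rewrite [RHS]big_mkcond; apply: eq_bigr => k _.
  by rewrite /scell; case: ifP; rewrite ?measure0.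
move=> k k' _ _ [z []]; rewrite /scell; case: asboolP => // _ kz.
by case: asboolP => // _ k'z; exact: cell_inj kz k'z.
Qed.

End Dyadic.

Section DyadicApproximation.
Variables (R : realType) (n : nat) (y : 'rV[R]_n)
  (m : {measure set (borel_rV R n) -> \bar R}).
Local Notation T := (borel_rV R n).
Local Notation K := (boxoc 0 y : set T).
Hypotheses (y_gt0 : forall i, 0 < y 0 i) (mK_fin : (m K < +oo)%E).
Implicit Types (z : 'rV[R]_n) (M : nat) (U A : set T).

Definition symdiff A U : set T := (A `\` U `|` U `\` A) `&` K.

Let mK : measurable K. Proof. exact: measurable_boxoc. Qed.

Let mIK A : measurable A -> measurable (A `&` K).
Proof. by move=> mA; exact: measurableI. Qed.

Let symdiffE A U : symdiff A U =
  ((A `&` K) `\` (U `&` K)) `|` ((U `&` K) `\` (A `&` K)).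
Proof.
apply/seteqP; split=> z.
  by move=> [[[Az Uz]|[Uz Az]] Kz]; [left|right]; split=> // -[].
by move=> [[[Az Kz] Uz]|[[Uz Kz] Az]]; split=> //; [left|right]; split=> // ?;
  [apply: Uz|apply: Az].
Qed.

Lemma measurable_symdiff A U : measurable (A `&` K) -> measurable (U `&` K) ->
  measurable (symdiff A U).
Proof.
by move=> mA mU; rewrite symdiffE; apply: measurableU; apply: measurableD.
Qed.

(** The sets with this property contain the open sets and form a sigma-algebra, hence include all
    Borel sets. *)
Definition dyadic_approx A := measurable A /\ forall eps : R, 0 < eps ->
  exists M U, saturated y M U /\ (m (symdiff A U) < eps%:E)%E.

Let approxC A : dyadic_approx A -> dyadic_approx (~` A).
Proof.
move=> [mA appA]; split; first exact: measurableC.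
move=> eps /appA[M [U [sU mAU]]]; exists M, (~` U); split.
  exact: saturatedC.
by rewrite (_ : symdiff _ _ = symdiff A U) // /symdiff !setDE !setCK setUC
  [~` A `&` _]setIC [~` U `&` _]setIC.
Qed.

Let approx0 : dyadic_approx set0.
Proof.
split=> // eps eps0; exists 0%N, set0; split=> //.
by rewrite /symdiff setDv setU0 set0I measure0 lte_fin.
Qed.

Let approxU A A' : dyadic_approx A -> dyadic_approx A' ->
  dyadic_approx (A `|` A').
Proof.
move=> [mA appA] [mA' appA']; split; first exact: measurableU.
move=> eps eps0; have e2 : 0 < eps / 2 by rewrite divr_gt0.
have [M [U [sU mAU]]] := appA _ e2; have [M' [U' [sU' mAU']]] := appA' _ e2.
have mU := measurable_saturated y_gt0 sU.
have mU' := measurable_saturated y_gt0 sU'.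
exists (maxn M M'), (U `|` U'); split.
  by apply: saturatedU; [apply: saturated_le sU|apply: saturated_le sU'];
    rewrite ?leq_maxl ?leq_maxr.
have mS : measurable (symdiff A U) by apply: measurable_symdiff => //;
  exact: mIK.
have mS' : measurable (symdiff A' U') by apply: measurable_symdiff => //;
  exact: mIK.
apply: (@le_lt_trans _ _ (m (symdiff A U `|` symdiff A' U'))).
  apply: le_measure; rewrite ?inE.
  - apply: measurable_symdiff; first by apply: mIK; exact: measurableU.
    by rewrite setIUl; exact: measurableU.
  - exact: measurableU.
  move=> z [+ Kz]; move=> [[[Az|Az] Uz]|[[Uz|Uz] Az]].
  - by left; split=> //; left; split=> // ?; apply: Uz; left.
  - by right; split=> //; left; split=> // ?; apply: Uz; right.
  - by left; split=> //; right; split=> // ?; apply: Az; left.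
  - by right; split=> //; right; split=> // ?; apply: Az; right.
apply: le_lt_trans (measureU2 _ mS mS') _.
by rewrite [eps]splitr EFinD; apply: lteD.
Qed.

(** Continuity from above at the empty set. Measurability is asked only within [K], which is all
    that is known of saturated sets. *)
Let approx_decreasing (A : nat -> set T) :
  (forall k, measurable (A k `&` K)) -> (forall k l, (k <= l)%N -> A l `<=` A
    k) ->
  (forall z, K z -> exists k, ~ A k z) ->
  forall eps : R, 0 < eps -> exists k, (m (A k `&` K) < eps%:E)%E.
Proof.
move=> mA And A0 eps eps0.
have Acvg : m \o (fun k => A k `&` K) @ \oo --> 0%E.
  have <- : m (\bigcap_k (A k `&` K)) = 0%E.
    rewrite (_ : \bigcap_k _ = set0) ?measure0 //; apply/seteqP;
      split=> // z AK.
    have [_ Kz] := AK 0%N I; have [k] := A0 _ Kz; apply.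
    by have [] := AK k I.
  apply: nonincreasing_cvg_mu => //.
  - apply: le_lt_trans mK_fin; apply: le_measure; rewrite ?inE //.
  - exact: bigcap_measurable.
  by move=> k l kl; apply/subsetPset => z [Az Kz]; split=> //; exact: And Az.
have [_ fcvg] := (fine_cvgP _ _).1 Acvg.
have [k _ /(_ k (leqnn k)) /= Ak] := cvgr_lt _ fcvg _ eps0.
exists k; rewrite -[m _]fineK ?lte_fin //.
rewrite ge0_fin_numE //; apply: le_lt_trans mK_fin.
by apply: le_measure; rewrite ?inE.
Qed.

Let approx_bigsetU (A : nat -> set T) k :
  (forall j, dyadic_approx (A j)) -> dyadic_approx (\bigcup_(j < k) A j).
Proof.
move=> appA; rewrite bigcup_mkord; elim: k => [|k ih].
  by rewrite big_ord0; exact: approx0.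
by rewrite big_ord_recr; exact: approxU.
Qed.

Let approx_bigcup (A : nat -> set T) :
  (forall j, dyadic_approx (A j)) -> dyadic_approx (\bigcup_j A j).
Proof.
move=> appA; have mA j : measurable (A j) by have [] := appA j.
have mUA : measurable (\bigcup_j A j) by exact: bigcupT_measurable.
split=> // eps eps0; have e2 : 0 < eps / 2 by rewrite divr_gt0.
(* Half of [eps] covers this tail of the union, the other half the approximation of the finite
   union. *)
pose B k := \bigcup_j A j `\` \bigcup_(j < k) A j.
have mB k : measurable (B k `&` K).
  by apply: mIK; apply: measurableD => //; have [] := approx_bigsetU k appA.
have [k mBk] : exists k, (m (B k `&` K) < (eps / 2)%:E)%E.
  apply: approx_decreasing => // [k l kl z [Uz nz]|z Kz].
    split=> // -[j /= jk Aj]; apply: nz; exists j => //=.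
    exact: leq_trans kl.
  have [[j _ Aj]|nA] := pselect ((\bigcup_j A j) z); last by exists 0%N => -[].
  by exists j.+1 => -[_]; apply; exists j => /=.
have [mAk /(_ _ e2)[M [U [sU mU]]]] := approx_bigsetU k appA.
exists M, U; split => //.
have mUK := measurable_saturated y_gt0 sU.
have mS : measurable (symdiff (\bigcup_(j < k) A j) U).
  by apply: measurable_symdiff => //; exact: mIK.
apply: (@le_lt_trans _ _ (m (B k `&` K `|` symdiff (\bigcup_(j < k) A j) U))).
  apply: le_measure; rewrite ?inE.
  - by apply: measurable_symdiff => //; exact: mIK.
  - exact: measurableU.
  move=> z [+ Kz]; have [kz|kz] := pselect ((\bigcup_(j < k) A j) z).
    move=> [[_ Uz]|[Uz nz]]; right; split=> //; first by left.
    by exfalso; apply: nz; have [j _ Aj] := kz; exists j.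
  move=> [[Az Uz]|[Uz nz]]; first by left.
  by right; split=> //; right.
apply: le_lt_trans (measureU2 _ (mB k) mS) _.
by rewrite [eps]splitr EFinD; apply: lteD.
Qed.

Let approx_open A : open (A : set 'rV[R]_n) -> dyadic_approx A.
Proof.
move=> oA; have mA : measurable A by exact: measurable_open.
split=> // eps eps0.
(* The cells of level M contained in [A]; they exhaust the open set within [K] as M grows. *)
pose U M : set T := [set z | forall z', sim y M z z' -> K z' -> A z'].
have sU M : saturated y M (U M).
  by move=> z z' zz' Uz z'' z'z''; apply: Uz; exact: sim_trans z'z''.
have UA M : U M `&` K `<=` A by move=> z [Uz Kz]; apply: Uz => //;
  exact: sim_refl.
pose B M := A `\` U M.
have BE M : B M `&` K = (A `&` K) `\` (U M `&` K).
  apply/seteqP; split=> z; first by move=> [[Az Uz] Kz]; split=> // -[].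
  by move=> [[Az Kz] Uz]; split=> //; split=> // ?; apply: Uz.
have mB M : measurable (B M `&` K).
  rewrite BE; apply: measurableD; first exact: mIK.
  exact: measurable_saturated (sU M).
have [M BM] : exists M, (m (B M `&` K) < eps%:E)%E.
  apply: approx_decreasing => // [k l kl z [Az nz]|z Kz].
    by split=> // Uz; apply: nz => z' /(sim_le kl); exact: Uz.
  have [Az|nA] := pselect (A z); last by exists 0%N => -[].
  have /nbhs_ballP[e /= e0 eA] : nbhs z A by exact: open_nbhs_nbhs.
  have [M yM] : exists M, forall i, y 0 i / (2 ^ M)%:R < e.
    (* Each y_i / e is below this level plus one, hence below 2^M, so the cells have sides shorter
       than [e]. *)
    exists (Num.truncn (\sum_i y 0 i / e)) => i.
    rewrite ltr_pdivrMr ?ltr0n ?expn_gt0 // mulrC -ltr_pdivrMr //.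
    apply: (@lt_le_trans _ _ (Num.truncn (\sum_i y 0 i / e)).+1%:R).
      apply: le_lt_trans (truncnS_gt _); rewrite (bigD1 i) //= lerDl.
      by apply: sumr_ge0 => j _; rewrite divr_ge0 // ltW.
    by rewrite ler_nat ltn_expl.
  exists M => -[_]; apply => z' zz' Kz'; apply: eA; split=> // r i.
  have [k /cellP kz] := cell_exists M Kz.
  have := kz i; rewrite ltNge !zz' -ltNge => /andP[kz1 kz2].
  have /andP[kz3 kz4] := kz i; have := yM i.
  have -> : y 0 i / (2 ^ M)%:R = dyadic_pt y M i (k i).+1 - dyadic_pt y M i (k
    i).
    by rewrite /dyadic_pt -natr1; ring.
  by rewrite ord1 /ball /= ltr_norml => ?; apply/andP; split; lra.
exists M, (U M); split => //.
suff -> : symdiff A (U M) = B M `&` K by [].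
apply/seteqP; split=> z [+ Kz]; last by split=> //; left.
by move=> [AU|[Uz Az]]; split => //; exfalso; apply: Az; apply: (UA M).
Qed.

Lemma borel_dyadic_approx A : measurable A -> dyadic_approx A.
Proof.
apply: smallest_sub => [|U oU]; last exact: approx_open.
split=> [|X aX|F aF]; first exact: approx0.
  by rewrite setTD; exact: approxC.
exact: approx_bigcup.
Qed.

End DyadicApproximation.

(** * Variation of a difference of mutually singular distribution functions *)

Section VitaliJordan.
Variables (R : realType) (n : nat).
Local Notation T := (borel_rV R n).
Variables (mp mm : {measure set T -> \bar R}) (P : set T) (f : 'rV[R]_n -> R).
Hypotheses (mP : measurable P) (mpP : mp (~` P) = 0%E) (mmP : mm P = 0%E)
  (mp_fin : forall y, orthant y -> (mp (boxoc 0 y) < +oo)%E)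
  (mm_fin : forall y, orthant y -> (mm (boxoc 0 y) < +oo)%E)
  (fE : forall x, orthant x -> f x = boxcdf mp x - boxcdf mm x).
Implicit Types (y : 'rV[R]_n).

(* For the lower bound, approximate the Hahn set P by a union U of cells: on
   the cells in U the negative part is small, on the others the positive one. *)
Lemma vitali_variation_jordan y : orthant y ->
  vitali_variation 0 y f = (boxcdf mp y + boxcdf mm y)%:E.
Proof.
move=> y0; apply/eqP; rewrite eq_le; apply/andP; split.
  apply: vitali_variation_le => //; [exact: boxcdf_vanishes..| |].
    by move=> *; exact: Delta_boxcdf_ge0.
  by move=> *; exact: Delta_boxcdf_ge0.
(* The dyadic grids need positive sides; on a face both distribution functions vanish. *)
have [[i yi]|yN] := pselect (exists i, y 0 i = 0).
  by rewrite !boxcdf_vanishes ?addr0 ?vitali_variation_ge0 //; exists i.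
have {}yN i : 0 < y 0 i.
  by rewrite lt_neqAle eq_sym y0 andbT; apply/eqP => yi; apply: yN; exists i.
(* Approximating with respect to the sum makes one set [U] good for both parts. *)
pose la := measure_add mp mm.
have laK : (la (boxoc 0 y) < +oo)%E.
  by rewrite /la measure_addE lte_add_pinfty // ?mp_fin ?mm_fin.
(* Two error sums, one for each part, enter the final estimate with factor 2: four quarters of
   [eps]. *)
apply/lee_addgt0Pr => eps eps0; have e4 : 0 < eps / 4 by rewrite divr_gt0.
have [_ /(_ _ e4)[M [U [sU laU]]]] := borel_dyadic_approx yN laK mP.
have sP := dyadicP yN M.
have mUK := measurable_saturated yN sU.
have mUCK := measurable_saturated yN (saturatedC sU).
have mS : measurable (symdiff y P U).
  by apply: measurable_symdiff => //; apply: measurableI => //;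
    exact: measurable_boxoc.
have mS_small (m : {measure set T -> \bar R}) : (forall A, m A <= la A)%E ->
    (m (symdiff y P U) < (eps / 4)%:E)%E by move=> mla; apply: le_lt_trans laU.
have mm_small : (mm (U `&` boxoc 0 y) < (eps / 4)%:E)%E.
  apply: (@le_lt_trans _ _ (mm (symdiff y P U))); last first.
    by apply: mS_small => A; rewrite /la measure_addE leeDr.
  rewrite -[leRHS]add0e -mmP; apply: le_trans (measureU2 _ mP mS).
  apply: le_measure; rewrite ?inE //; first exact: measurableU.
  by move=> z [Uz Kz]; have [?|nP] := pselect (P z); [left|right; split => //;
    right].
have mp_small : (mp (~` U `&` boxoc 0 y) < (eps / 4)%:E)%E.
  apply: (@le_lt_trans _ _ (mp (symdiff y P U))); last first.
    by apply: mS_small => A; rewrite /la measure_addE leeDl.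
  have mPC : measurable (~` P) by exact: measurableC.
  rewrite -[leRHS]add0e -mpP; apply: le_trans (measureU2 _ mPC mS).
  apply: le_measure; rewrite ?inE //; first exact: measurableU.
  by move=> z [Uz Kz]; have [?|nP] := pselect (P z); [right; split => //;
    left|left].
pose p (k : {dffun forall i : 'I_n, 'I_(size (dyadic y M i))}) :=
  Delta (glo 0 k) (ghi k) (boxcdf mp).
pose q (k : {dffun forall i : 'I_n, 'I_(size (dyadic y M i))}) :=
  Delta (glo 0 k) (ghi k) (boxcdf mm).
have celle (m : {measure set T -> \bar R}) :
    (forall y, orthant y -> (m (boxoc 0 y) < +oo)%E) -> forall k,
    (Delta (glo 0 k) (ghi k) (boxcdf m))%:E = m (cell (y := y) (M := M) k).
  move=> m_fin k; have g0 := orthant_glo k sP; have gh := vle_cell k sP.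
  rewrite Delta_boxcdf // fineK //; apply: boxoc_fin => //.
  by apply/vle0; apply: vle_trans gh; apply/vle0.
have qU : \sum_(k | `[< U (ghi k) >]) q k < eps / 4.
  rewrite -lte_fin -sumEFin; under eq_bigr do rewrite celle //.
  by rewrite -measure_saturated.
have pU : \sum_(k | `[< (~` U) (ghi k) >]) p k < eps / 4.
  rewrite -lte_fin -sumEFin; under eq_bigr do rewrite celle //.
  by rewrite -measure_saturated //; exact: saturatedC.
apply: (@le_trans _ _ ((grid_variation 0 y f (dyadic y M))%:E + eps%:E)%E);
  last first.
  by rewrite leeD2r //; apply: ereal_sup_ubound; exists (dyadic y M).
rewrite -EFinD lee_fin -lerBlDr.
rewrite -[boxcdf mp y](Delta0_vanishes y0 (@boxcdf_vanishes _ _ mp)).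
rewrite -[boxcdf mm y](Delta0_vanishes y0 (@boxcdf_vanishes _ _ mm)).
rewrite -!(grid_telescope _ sP) -!/(p _) -!/(q _).
(* The part that is small on the cell. In both cases |p - q| >= p + q - 2r. *)
pose r k := if `[< U (ghi k) >] then q k else p k.
have rE : \sum_k r k = \sum_(k | `[< U (ghi k) >]) q k + \sum_(k | `[< (~` U)
  (ghi k) >]) p k.
  rewrite (bigID (fun k => `[< U (ghi k) >])) /=; congr (_ + _).
    by apply: eq_bigr => k; rewrite /r => ->.
  apply: eq_big => [k|k /negbTE]; last by rewrite /r => ->.
  by rewrite asbool_neg.
have key : \sum_k p k + \sum_k q k - (\sum_k r k) *+ 2 <= grid_variation 0 y f
  (dyadic y M).
  rewrite mulr2n -!big_split /= -sumrB; apply: ler_sum => k _.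
  have g0 := orthant_glo k sP; have gh := vle_cell k sP.
  rewrite -[Delta _ _ f]/(Delta (glo 0 k) (ghi k) f).
  have -> : Delta (glo 0 k) (ghi k) f = p k - q k.
    rewrite -DeltaB; apply: eq_Delta => // z gz _; apply: fE.
    by apply/vle0; apply: vle_trans gz; apply/vle0.
  have p0 : 0 <= p k by exact: Delta_boxcdf_ge0.
  have q0 : 0 <= q k by exact: Delta_boxcdf_ge0.
  rewrite /r; case: asboolP => _.
    by apply: le_trans (ler_norm _); lra.
  by rewrite distrC; apply: le_trans (ler_norm _); lra.
apply: le_trans key; rewrite rE; lra.
Qed.

End VitaliJordan.

Lemma rcontinuous_eq (R : realType) n (f g : 'rV[R]_n -> R) :
  (forall x, orthant x -> f x = g x) -> rcontinuous g -> rcontinuous f.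
Proof.
move=> fg gc x x0 i; rewrite fg //; apply: cvg_trans (gc x x0 i).
apply: near_eq_cvg; near=> t; rewrite fg // => j; rewrite shiftE.
have t0 : 0 < t by near: t; exact: nbhs_right_gt.
by case: ifP => // _; rewrite addr_ge0 // ltW.
Unshelve. all: by end_near. Qed.

(** * Lower marginals *)

Section FillRestr.
Variables (R : realType) (n : nat) (I : {set 'I_n}).
Implicit Types (x : 'rV[R]_n) (y : 'rV[R]_#|I|) (e : 'I_n -> R).

Lemma fill_in y e j : fill y e 0 (enum_val j) = y 0 j.
Proof.
rewrite mxE; case: pickP => [k /eqP /enum_val_inj -> //|/(_ j)].
by rewrite eqxx.
Qed.

Lemma fill_out y e i : i \notin I -> fill y e 0 i = e i.
Proof.
move=> iI; rewrite mxE; case: pickP => // k /eqP ki.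
by rewrite -ki enum_valP in iI.
Qed.

Lemma in_enum_val i : i \in I -> exists j : 'I_#|I|, i = enum_val j.
Proof. by move=> iI; exists (enum_rank_in iI i); rewrite enum_rankK_in. Qed.

Lemma fill_restr x e : fill (restr I x) e = \row_i (if i \in I then x 0 i else
  e i).
Proof.
apply/rowP => i; rewrite [RHS]mxE; case: ifPn => iI; last exact: fill_out.
by have [j ->] := in_enum_val iI; rewrite fill_in mxE.
Qed.

Lemma orthant_restr x : orthant x -> orthant (restr I x).
Proof. by move=> x0 j; rewrite mxE. Qed.

Lemma orthant_fill y e : orthant y -> (forall i, 0 <= e i) -> orthant (fill y
  e).
Proof.
move=> y0 e0 i; have [iI|iI] := boolP (i \in I); last by rewrite fill_out.
by have [j ->] := in_enum_val iI; rewrite fill_in.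
Qed.

Lemma restr0 : restr I (0 : 'rV[R]_n) = 0.
Proof. by apply/rowP => j; rewrite !mxE. Qed.

Lemma fill_shift y t j e :
  fill (y + t *: unitv R j) e = fill y e + t *: unitv R (enum_val j).
Proof.
apply/rowP => i; rewrite shiftE.
have [iI|iI] := boolP (i \in I).
  have [k ->] := in_enum_val iI; rewrite !fill_in shiftE.
  by rewrite (inj_eq enum_val_inj).
rewrite !fill_out //; case: eqP => // ji.
by rewrite -ji enum_valP in iI.
Qed.

Lemma fill_upd y e i u : fill y [eta e with i |-> u] =
  if i \in I then fill y e else upd (fill y e) i u.
Proof.
apply/rowP => k; have [iI|iI] := boolP (i \in I);
  have [kI|kI] := boolP (k \in I).
- by have [j ->] := in_enum_val kI; rewrite !fill_in.
- by rewrite !fill_out //=; case: eqP => // ki; rewrite ki iI in kI.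
- have ki : k != i by apply: contraNneq iI => <-.
  by rewrite [RHS]mxE (negbTE ki); have [j ->] := in_enum_val kI;
    rewrite !fill_in.
- by rewrite [RHS]mxE !fill_out.
Qed.

Lemma restr_shift x t i : restr I (x + t *: unitv R i) =
  if [pick j : 'I_#|I| | enum_val j == i] is Some j
  then restr I x + t *: unitv R j else restr I x.
Proof.
case: pickP => [j /eqP ji|noj]; apply/rowP => k; rewrite mxE !shiftE.
  by rewrite -ji (inj_eq enum_val_inj) mxE.
by rewrite mxE; case: eqP => // ik; have := noj k; rewrite -ik eqxx.
Qed.

End FillRestr.

Section Marginals.
Variables (R : realType) (n : nat) (f : 'rV[R]_n -> R).
Hypothesis fc : rcontinuous f.
Implicit Types (x : 'rV[R]_n) (I : {set 'I_n}).

Lemma is_marginal_fill I (y : 'rV[R]_#|I|) : orthant y ->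
  is_marginal_at 0 f I y (f (fill y (fun=> 0))).
Proof.
move=> y0 s sE.
have p0 : (0 : 'rV[R]_n) 0 = (fun=> 0) by apply/funext => i; rewrite mxE.
rewrite p0.
have rcG e : (forall t, 0 <= e t) -> forall t,
    (f \o @pos R n) (fill y [eta e with t |-> u]) @[u --> (e t)^'+] -->
    (f \o @pos R n) (fill y e).
  move=> e0 t; under eq_fun do rewrite fill_upd.
  have [tI|tI] := boolP (t \in I); first exact: cvg_cst.
  have := @rc_everywhere_upd R n _ (fill y e) t (rc_everywhere_pos fc).
  by rewrite fill_out.
have := @iterlim_rcontinuous R 'I_n (fun=> 0) s _ (fun=> 0) rcG (fun=> lexx 0).
have -> : (fun t => if t \in s then 0 else 0) = (fun=> 0) :> ('I_n -> R).
  by apply/funext => t; rewrite if_same.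
rewrite /=.
rewrite pos_id; last exact: orthant_fill.
apply: eq_iterlim; last by rewrite (perm_uniq sE) enum_uniq.
move=> e e1 e2 /=; rewrite pos_id //; apply: orthant_fill => // i.
by have [/e1/ltW|/e2->] := boolP (i \in s).
Qed.

Lemma has_marginal_rc I : has_marginal f I.
Proof. by move=> y y0; eexists; exact: is_marginal_fill. Qed.

Lemma marginalE I (y : 'rV[R]_#|I|) : orthant y ->
  marginal f I y = f (fill y (fun=> 0)).
Proof.
move=> y0; apply: xget_unique; first exact: is_marginal_fill.
move=> L /(_ (enum (~: I)%SET) (perm_refl _)) L1.
exact: iterlim_unique L1 (is_marginal_fill y0 (perm_refl _)).
Qed.

Lemma marginal_restrE I x : orthant x ->
  marginal f I (restr I x) = f (mix I 0 x).
Proof.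
move=> x0; rewrite marginalE; last exact: orthant_restr.
by congr f; rewrite fill_restr; apply/rowP => i; rewrite !mxE.
Qed.

Lemma rcontinuous_marginal I : rcontinuous (marginal f I).
Proof.
apply: (rcontinuous_eq (@marginalE I)) => y y0 j.
under eq_fun do rewrite fill_shift.
by apply: fc; exact: orthant_fill.
Qed.

Lemma has_Ftrans_rc : has_Ftrans f.
Proof. by move=> J _; exact: has_marginal_rc. Qed.

Lemma Ftrans_Delta x : orthant x -> Ftrans f x = Delta 0 x f.
Proof.
move=> x0; rewrite DeltaE (bigD1 [set: 'I_n]%SET) //=.
rewrite cardsT card_ord subnn expr0 mul1r /Ftrans; congr (_ + _).
  by congr f; apply/rowP => i; rewrite mxE inE.
rewrite -sumrN; apply: eq_big => [J|J JT]; first exact: properT.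
rewrite marginal_restrE // -mulNr; congr (_ * _).
(* The exponent n - |J| - 1 is a truncated subtraction; that [J] is proper makes it differ from n -
   |J| by exactly one, which accounts for the sign. *)
have : (0 < n - #|J|)%N.
  by rewrite subn_gt0; have := proper_card JT; rewrite cardsT card_ord.
by case: (n - #|J|)%N => // k _; rewrite subn1 exprS mulN1r.
Qed.

End Marginals.

(** * Transport along equal dimensions and the full index set *)

Lemma cast_transfer (R : realType) (P : forall n, ('rV[R]_n -> R) -> Prop)
    m n (e : m = n) (f : 'rV[R]_n -> R) :
  P m (fun x => f (castmx (erefl, e) x)) -> P n f.
Proof.
case: n / e f => f; rewrite (_ : (fun x => _) = f) //.
Qed.

Lemma eq_vitali_variation (R : realType) n (f g : 'rV[R]_n -> R) y :
  (forall x, orthant x -> f x = g x) ->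
  vitali_variation 0 y f = vitali_variation 0 y g.
Proof.
move=> fg; congr ereal_sup; apply/seteqP; split=> _ [s sP ->]; exists s => //;
  congr (_%:E); apply: eq_bigr => k _; congr `|_|; apply: eq_Delta;
  try exact: vle_cell sP; move=> z gz _; rewrite fg //;
  by apply/vle0; apply: vle_trans gz; apply/vle0; exact: orthant_glo sP.
Qed.

Lemma vitali_variation_cast (R : realType) m n (e : m = n)
    (f : 'rV[R]_n -> R) y :
  vitali_variation 0 (castmx (erefl, esym e) y) (fun x => f (castmx (erefl, e)
    x))
  = vitali_variation 0 y f.
Proof.
case: n / e f y => f y; rewrite castmx_id.
by congr vitali_variation; apply/funext => x; rewrite castmx_id.
Qed.

Section FullSet.
Variables (R : realType) (n : nat).

(** An equation between numbers, not a conversion: functions are moved along it by [castmx]. *)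
Lemma card_full : #|[set: 'I_n]%SET| = n.
Proof. by rewrite cardsT card_ord. Qed.

Lemma enum_val_full (j : 'I_#|[set: 'I_n]%SET|) :
  enum_val j = cast_ord card_full j.
Proof.
apply: val_inj; rewrite (enum_val_nth (cast_ord card_full j)) enum_setT -enumT
  /=.
by rewrite nth_enum_ord // -[X in (_ < X)%N]card_full.
Qed.

Implicit Types (f : 'rV[R]_n -> R) (x y : 'rV[R]_n).

Lemma fill_full (y : 'rV[R]_#|[set: 'I_n]%SET|) e :
  fill y e = castmx (erefl, card_full) y.
Proof.
apply/rowP => i; have iT : i \in [set: 'I_n]%SET by rewrite inE.
have [j ->] := in_enum_val iT; rewrite fill_in castmxE /= cast_ord_id.
by congr (y _ _); rewrite enum_val_full cast_ordK.
Qed.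

Lemma restr_full x :
  restr [set: 'I_n]%SET x = castmx (erefl, esym card_full) x.
Proof.
apply/rowP => j; rewrite mxE castmxE /= cast_ord_id; congr (x _ _).
by rewrite enum_val_full; apply: val_inj.
Qed.

Lemma VarHK_grounded f y : (0 < n)%N -> rcontinuous f -> vanishes_on_axes f ->
  orthant y -> VarHK f 0 y = vitali_variation 0 y f.
Proof.
move=> n0 fc f0 y0; rewrite /VarHK (bigD1 [set: 'I_n]%SET) /=; last first.
  by rewrite -card_gt0 card_full.
rewrite big1 ?adde0.
  rewrite restr0 -(vitali_variation_cast card_full) restr_full.
  apply: eq_vitali_variation => x x0; rewrite -/(marginal _ _) marginalE //.
  by rewrite fill_full.
move=> I /andP[_ IT].
have [i iI] : exists i, i \notin I.
  apply/existsP; apply: contraNT IT; rewrite negb_exists => /forallP IT.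
  by apply/eqP/setP => i; rewrite inE; have := IT i; rewrite negbK.
rewrite restr0 (@eq_vitali_variation _ _ _ (fun=> 0)).
  rewrite (vitali_variation_monotone (orthant_restr y0)) // => a b a0 ab.
  rewrite DeltaE; apply: sumr_ge0 => J _; rewrite mulr0 //.
move=> x x0; rewrite -/(marginal _ _) marginalE // f0 //.
  exact: orthant_fill.
by exists i; rewrite fill_out.
Qed.

End FullSet.

(** * Moebius inversion over index sets *)

Section Moebius.
Variables (R : realType) (n : nat).
Implicit Types (f : 'rV[R]_n -> R) (x y : 'rV[R]_n).

Lemma pdiffsZ m s eps (c : R) (f : 'rV[R]_m -> R) z :
  pdiffs s eps (fun z => c * f z) z = c * pdiffs s eps f z.
Proof. by elim: s z => [|i s ih] z //=; rewrite /pdiff !ih mulrBr. Qed.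

Lemma prodfun_fill (I : {set 'I_n}) phi (y : 'rV[R]_#|I|) :
  prodfun phi (fill y (fun=> 0)) =
  (\prod_(i | i \notin I) phi i 0) * prodfun (fun j => phi (enum_val j)) y.
Proof.
rewrite /prodfun (bigID (mem I)) /= mulrC; congr (_ * _).
  by apply: eq_bigr => i iI; rewrite fill_out.
rewrite big_enum_val; apply: eq_bigr => j _; by rewrite fill_in.
Qed.

(** On a product function this is the expansion of prod_i ((phi_i(x_i) - phi_i(0)) + phi_i(0)): [I]
    collects the coordinates contributing a difference. *)
Lemma sum_Delta_marginals f x :
  f x = \sum_(I : {set 'I_n})
          Delta 0 (restr I x) (fun z : 'rV[R]_#|_| => f (fill z (fun=> 0))).
Proof.
move: f; apply: finlin_eq; first exact: finlin_eval.
  apply: finlin_sum => I.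
  apply: (@finlin_Delta _ _ _ (fun f (z : 'rV[R]_#|I|) => f (fill z (fun=>
    0)))) => z.
  exact: finlin_eval.
move=> phi; transitivity (\prod_i ((phi i (x 0 i) - phi i 0) + phi i 0)).
  by apply: eq_bigr => i _; rewrite subrK.
rewrite bigA_distr; apply: eq_big => [I|I _]; first by rewrite inE.
have -> : (fun z : 'rV[R]_#|I| => prodfun phi (fill z (fun=> 0))) =
    (fun z => (\prod_(i | i \notin I) phi i 0) *
       prodfun (fun j => phi (enum_val j)) z).
  by apply/funext => z; exact: prodfun_fill.
rewrite /Delta pdiffsZ -/(Delta _ _ _) Delta_prod.
rewrite (bigID (mem I)) /= mulrC; congr (_ * _).
  by apply: eq_bigr => i /negbTE ->.
rewrite big_enum_val; apply: eq_bigr => j _.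
by rewrite enum_valP !mxE.
Qed.

Lemma Delta_marginal0 f x :
  Delta 0 (restr finset.set0 x) (fun z : 'rV[R]_#|_| => f (fill z (fun=> 0))) =
    f 0.
Proof.
have e0 : enum 'I_#|(finset.set0 : {set 'I_n})| = [::].
  by apply: size0nil; rewrite size_enum_ord cards0.
rewrite /Delta e0 /=; congr f; apply/rowP => i.
by rewrite fill_out ?inE // mxE.
Qed.

Lemma sum_by_card (X : {set 'I_n} -> R) :
  \sum_(1 <= k < n.+1) \sum_(I : {set 'I_n} | #|I| == k) X I =
  \sum_(I : {set 'I_n} | I != finset.set0) X I.
Proof.
rewrite big_nat (exchange_big_dep (fun I : {set 'I_n} => I != finset.set0)) /=.
  apply: eq_bigr => I I0.
  have cI : (#|I| < n.+1)%N by rewrite ltnS -[n in leqRHS]card_ord max_card.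
  rewrite (eq_bigl (fun k => (1 <= k < n.+1)%N && (k == #|I|))); last first.
    by move=> k; rewrite [#|I| == k]eq_sym.
  rewrite -big_nat_cond.
  by rewrite big_nat1_eq card_gt0 I0 cI.
by move=> k I /andP[k1 _] /eqP kI; rewrite -card_gt0 kI.
Qed.

End Moebius.

(** * One-sided limits and membership in [Fmic] *)

Section LeftLimits.
Variable R : realType.

Definition left_limits n (f : 'rV[R]_n -> R) := forall x i, orthant x ->
  0 < x 0 i -> cvg (f (x - t *: unitv R i) @[t --> (0 : R)^'+]).

Lemma near_orthant n (x : 'rV[R]_n) i : orthant x -> 0 < x 0 i ->
  \forall t \near (0 : R)^'+, orthant (x - t *: unitv R i).
Proof.
move=> x0 xi; near=> t => j; rewrite -scaleNr shiftE; case: eqP => // <-.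
by rewrite subr_ge0; near: t; exact: nbhs_right_le.
Unshelve. all: by end_near. Qed.

Lemma left_limits_eq n (f g : 'rV[R]_n -> R) :
  (forall x, orthant x -> f x = g x) -> left_limits g -> left_limits f.
Proof.
move=> fg gl x i x0 xi; have [l gxl] := (cvg_ex _).1 (gl x i x0 xi).
apply: (cvgP l); apply: cvg_trans gxl; apply: near_eq_cvg.
by apply: filterS (near_orthant x0 xi) => t /fg.
Qed.

Lemma left_limits_cst n (c : R) : left_limits (fun _ : 'rV[R]_n => c).
Proof. by move=> x i _ _; exact: is_cvg_cst. Qed.

Lemma left_limitsD n (f g : 'rV[R]_n -> R) : left_limits f -> left_limits g ->
  left_limits (fun x => f x + g x).
Proof. by move=> fl gl x i x0 xi; apply: is_cvgD; [exact: fl|exact: gl]. Qed.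

Lemma left_limitsB n (f g : 'rV[R]_n -> R) : left_limits f -> left_limits g ->
  left_limits (fun x => f x - g x).
Proof. by move=> fl gl x i x0 xi; apply: is_cvgB; [exact: fl|exact: gl]. Qed.

Lemma left_limits_sum n (J : Type) (r : seq J) (P : pred J) (f : J -> 'rV[R]_n
  -> R) :
  (forall j, P j -> left_limits (f j)) ->
  left_limits (fun x => \sum_(j <- r | P j) f j x).
Proof.
move=> fl; elim: r => [|j r ih].
  apply: left_limits_eq (@left_limits_cst n 0) => x _; exact: big_nil.
have := ih; have [Pj|nPj] := boolP (P j); last first.
  by apply: left_limits_eq => x _; rewrite big_cons (negbTE nPj).
move=> /(left_limitsD (fl j Pj)); apply: left_limits_eq => x _.
by rewrite big_cons Pj.
Qed.

Lemma le_shift n (g : 'rV[R]_n -> R) x t i : Delta_monotone g -> orthant x -> 0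
  <= t ->
  g x <= g (x + t *: unitv R i).
Proof.
move=> gm x0; rewrite le_eqVlt => /orP[/eqP <-|t0].
  by rewrite scale0r addr0.
have n0 : (1 <= 1 <= n)%N by case: (n) i => [[]|].
have := gm 1%N n0 [tuple i] isT (fun=> t) (fun=> t0) x x0.
by rewrite /= /pdiff subr_ge0.
Qed.

(** The 1-increasing case of monotonicity makes g(x - t e_i) nonincreasing in t, and it is bounded
    above by g(x). *)
Lemma left_limits_monotone n (g : 'rV[R]_n -> R) : Delta_monotone g ->
  left_limits g.
Proof.
move=> gm x i x0 xi.
have ox t : t < x 0 i -> orthant (x - t *: unitv R i).
  by move=> tx j; rewrite -scaleNr shiftE; case: eqP => // <-;
    rewrite subr_ge0 ltW.
apply: nonincreasing_at_right_is_cvgr.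
  near=> e; move=> t t'; rewrite !in_itv /= => /andP[t0 te] /andP[t'0 t'e] tt'.
  have ex : e <= x 0 i by near: e; exact: nbhs_right_le.
  have -> : x - t *: unitv R i = x - t' *: unitv R i + (t' - t) *: unitv R i.
    by rewrite scalerBl addrA subrK.
  apply: le_shift; rewrite ?subr_ge0 //; apply: ox.
  exact: lt_le_trans ex.
near=> e; exists (g x) => _ [t /= + <-]; rewrite in_itv /= => /andP[t0 te].
have ex : e <= x 0 i by near: e; exact: nbhs_right_le.
have xt0 : orthant (x - t *: unitv R i) by apply: ox; apply: lt_le_trans ex.
by have := le_shift i gm xt0 (ltW t0); rewrite subrK.
Unshelve. all: by end_near. Qed.

Lemma left_limits_restr n (I : {set 'I_n}) (g : 'rV[R]_#|I| -> R) :
  left_limits g -> left_limits (fun x => g (restr I x)).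
Proof.
move=> gl x i x0 xi; under eq_fun do rewrite -scaleNr restr_shift.
case: pickP => [j /eqP ji|_]; last exact: is_cvg_cst.
under eq_fun do rewrite scaleNr.
by apply: gl; [exact: orthant_restr|rewrite mxE ji].
Qed.

Lemma left_limits_marginal n (f : 'rV[R]_n -> R) I : rcontinuous f ->
  left_limits f -> left_limits (marginal f I).
Proof.
move=> fc fl; apply: (left_limits_eq (marginalE fc (I := I))) => y j y0 yj.
under eq_fun do rewrite -scaleNr fill_shift scaleNr.
by apply: fl; [exact: orthant_fill|rewrite fill_in].
Qed.

Lemma rcontinuous_restr n (I : {set 'I_n}) (g : 'rV[R]_#|I| -> R) :
  rcontinuous g -> rcontinuous (fun x => g (restr I x)).
Proof.
move=> gc x x0 i; under eq_fun do rewrite restr_shift.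
case: pickP => [j _|_]; last exact: cvg_cst.
by apply: gc; exact: orthant_restr.
Qed.

Lemma rcontinuousB n (f g : 'rV[R]_n -> R) : rcontinuous f -> rcontinuous g ->
  rcontinuous (fun x => f x - g x).
Proof. by move=> fc gc x x0 i; apply: cvgB; [exact: fc|exact: gc]. Qed.

Lemma Fmic_rcontinuous n (q : 'rV[R]_n -> R) : rcontinuous q ->
  left_limits q -> measure_inducing q -> Fmic q.
Proof.
move=> qc ql qm; split=> //.
- move=> x x0 i; split; last exact: ql.
  by apply: (cvgP (q x)); exact: qc.
- move=> x x_gt0; have x0 : orthant x by move=> i; exact: ltW.
  (* Right continuity permits approaching [x] from the upper corner, with the coordinates in their
     natural order. *)
  exists 1%g, (fun=> 1); split; first by right.
  pose G (e : 'I_n -> R) := (q \o @pos R n) (\row_i (x 0 i + e i)).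
  have rcG e : (forall t, 0 <= e t) -> forall t,
      G [eta e with t |-> u] @[u --> (e t)^'+] --> G e.
    move=> e0 t; apply/cvg_at_right_shift.
    have := @rc_everywhere_pos R n q qc (\row_i (x 0 i + e i)) t.
    apply: cvg_trans; apply: near_eq_cvg; apply: nearW => u.
    congr (_ _); apply/rowP => j; rewrite shiftE !mxE /= eq_sym.
    by case: eqP => [->|//]; rewrite addrA.
  have := @iterlim_rcontinuous R 'I_n (fun=> 0) (enum 'I_n) G (fun=> 0) rcG
    (fun=> lexx 0).
  have -> : (fun t => if t \in enum 'I_n then 0 else 0) = (fun=> 0) :> ('I_n ->
    R).
    by apply/funext => t; rewrite if_same.
  have -> : G (fun=> 0) = q x.
    rewrite /G /= (_ : \row_i _ = x) ?pos_id //.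
    by apply/rowP => i; rewrite mxE addr0.
  apply: eq_iterlim; last exact: enum_uniq.
  move=> e e0 _; rewrite /G /= pos_id; last first.
    by move=> i; rewrite mxE addr_ge0 // ltW // e0 // mem_enum.
  congr q; apply/rowP => i; rewrite !mxE summxE (bigD1 i) //= big1 ?addr0.
    by rewrite perm1 /unitv !mxE !eqxx mulr1 mul1r.
  by move=> j ji; rewrite perm1 /unitv !mxE eqxx eq_sym (negbTE ji) mulr0.
- by move=> x i x0 _; exact: qc.
Qed.

End LeftLimits.

Section Dimension0.
Variables (R : realType) (q : 'rV[R]_0 -> R).

(** The space is a single point and D takes no differences, so [q 0] times the Dirac measure induces
    [q]. *)
Lemma measure_inducing_dim0 : measure_inducing q.
Proof.
pose T : measurableType _ := borel_rV R 0.
pose dl : {measure set T -> \bar R} := @dirac _ T (0 : 'rV[R]_0) R.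
have dlE (A : set T) : (exists b : bool, dl A = (b%:R)%:E).
  by exists (0 \in A); rewrite /dl /= diracE.
exists (fun A => (q 0)%:E * dl A)%E; split; first split.
- by rewrite measure0 mule0.
- by move=> [[A _]]; have [b ->] := dlE A.
- move=> F bF tF.
  have mF k : measurable (F k : set T) by have [] := bF k.
  have mUF : measurable (\bigcup_k F k : set T) by apply: bigcupT_measurable.
  under eq_fun do rewrite -ge0_sume_distrr //.
  by apply: cvgeZl => //; exact: measure_semi_sigma_additive.
move=> x y _ _; exists (q 0).
  move=> s sE; have -> : s = [::].
    apply: size0nil; rewrite (perm_size sE) -cardE card_sum card_ord //.
  rewrite /= /Delta (_ : enum 'I_0 = [::]) /=; first by congr q;
    apply/rowP => -[].
  by apply: size0nil; rewrite size_enum_ord.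
rewrite (_ : cbox x y = setT); last by apply/seteqP; split=> // z _;
  split=> -[].
by rewrite /dl /= diracT mule1.
Qed.

End Dimension0.

(** * The equivalence and the uniqueness *)

Section Characterization.
Variables (R : realType).

Lemma vanishes_Delta0 n (q : 'rV[R]_n -> R) :
  vanishes_on_axes (fun y => Delta 0 y q).
Proof.
by move=> y y0 [i yi]; rewrite (@Delta_degenerate _ _ _ _ i) // mxE yi.
Qed.

Lemma is_D_origin n (q : 'rV[R]_n -> R) y L : rcontinuous q -> orthant y ->
  is_D 0 y q L -> L = Delta 0 y q.
Proof.
move=> qc y0 qL; pose s := enum {: 'I_n + 'I_n}.
pose G (e : 'I_n + 'I_n -> R) := Delta 0 (\row_i (y 0 i + e (inr i))) (q \o
  @pos R n).
have LG : iterlim (fun=> 0) s G (fun=> 0) L.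
  apply: eq_iterlim (qL s (perm_refl _)); last exact: enum_uniq.
  move=> e e0 _; rewrite /G Delta_pos; congr Delta; apply/rowP => i;
    rewrite !mxE.
    by rewrite sub0r maxxx; apply/max_idPl;
      rewrite oppr_le0 ltW // e0 // mem_enum.
  by apply/esym/max_idPr; rewrite addr_ge0 // ltW // e0 // mem_enum.
have rcG e : (forall t, 0 <= e t) -> forall t,
    G [eta e with t |-> u] @[u --> (e t)^'+] --> G e.
  move=> e0 [j|j].
    rewrite (_ : (fun u => _) = fun=> G e); first exact: cvg_cst.
    by apply/funext => u; congr Delta; apply/rowP => i; rewrite !mxE.
  apply/cvg_at_right_shift.
  have := @cvg_Delta_updr R n _ 0 (\row_i (y 0 i + e (inr i))) j
    (rc_everywhere_pos qc).
  move=> /cvg_at_right_shift; rewrite mxE.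
  apply: cvg_trans; apply: near_eq_cvg; apply: nearW => u.
  congr Delta; apply/rowP => i; rewrite !mxE /=.
  by rewrite (inj_eq (@inr_inj _ _)); case: eqP => [->|//]; rewrite addrA.
have := @iterlim_rcontinuous R _ (fun=> 0) s G (fun=> 0) rcG (fun=> lexx 0).
have -> : (fun t => if t \in s then 0 else 0) = (fun=> 0) :> ('I_n + 'I_n -> R).
  by apply/funext => t; rewrite if_same.
move=> /(iterlim_unique LG) ->; rewrite /G Delta_pos !pos_id //.
- by congr Delta; apply/rowP => i; rewrite mxE addr0.
- by move=> i; rewrite mxE addr0.
- exact: orthant0.
Qed.

(* The clauses of [decomposition] for a single index set I, with q = f_I. *)
Definition jordan_pair n (q g h : 'rV[R]_n -> R) :=
  [/\ [/\ rcontinuous g, Delta_monotone g & grounded g] /\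
      [/\ rcontinuous h, Delta_monotone h & grounded h],
      bounded_on_orthant g \/ bounded_on_orthant h,
      g 0 = 0 /\ h 0 = 0 &
      forall y, orthant y ->
        [/\ Ftrans q y = g y - h y,
            VarHK (Ftrans q) 0 y = (VarHK g 0 y + VarHK h 0 y)%E &
            (VarHK (Ftrans q) 0 y < +oo)%E]].

Lemma VarHK_monotone n (g : 'rV[R]_n -> R) y : (0 < n)%N ->
  [/\ rcontinuous g, Delta_monotone g & grounded g] -> orthant y ->
  VarHK g 0 y = (g y)%:E.
Proof.
move=> n0 [gc gm gg] y0; have g0 := grounded_vanishes gc gg.
rewrite VarHK_grounded // vitali_variation_monotone // => a b a0 ab.
exact: Delta_monotone_ge0.
Qed.

Lemma jordan_pair_unique n (q g h g' h' : 'rV[R]_n -> R) y : (0 < n)%N ->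
  jordan_pair q g h -> jordan_pair q g' h' -> orthant y ->
  g y = g' y /\ h y = h' y.
Proof.
move=> n0 [[gP hP] _ _ qE] [[g'P h'P] _ _ qE'] y0.
have [F1 V1 _] := qE y y0; have [F2 V2 _] := qE' y y0.
have D : g y - h y = g' y - h' y by rewrite -F1.
have S : g y + h y = g' y + h' y.
  have : (g y + h y)%:E = (g' y + h' y)%:E.
    by rewrite !EFinD -!(VarHK_monotone n0 _ y0) // -V1 -V2.
  by case.
by split; lra.
Qed.

Lemma exists_jordan_pair n (q : 'rV[R]_n -> R) : (0 < n)%N ->
  rcontinuous q -> measure_inducing q -> exists g h, jordan_pair q g h.
Proof.
move=> n0 qc [nu [[nu0 nu_noty nu_sigma] nuD]].
pose T := borel_rV R n.
have mO : measurable (@orthant R n : set T).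
  by apply: (@measurable_forall _ _ (fun i => [set z : T | 0 <= z 0 i])) => i;
    exact: measurable_coord_ge.
(* [nu] is only controlled on Borel subsets of the orthant; intersecting makes it a signed measure
   on all Borel sets. *)
pose nu' (A : set T) := nu (A `&` @orthant R n).
have bO (A : set T) : measurable A -> borel_orthant (A `&` @orthant R n).
  by move=> mA; split; [exact: (@measurableI _ (borel_rV R n) _ _ mA mO)|move=>
    z []].
have [|||y y0||mp [mm [P [mP mpP mmP mfin mE]]]] := @signed_measure_jordan R n
  nu' (fun y => Delta 0 y q).
- by rewrite /nu' set0I.
- move=> A mA tA mUA; rewrite /nu' setI_bigcupl; apply: nu_sigma.
    by move=> k; exact: bO.
  exact: trivIset_setIr.
- move=> A B mA mB Aoo Boo; apply: nu_noty; split;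
  [exists (A `&` @orthant R n)|exists (B `&` @orthant R n)] => //; exact: bO.
- rewrite /nu' (setIidl _); last by move=> z [/vle0].
  have [L LD ->] := nuD 0 y (@orthant0 R n) ((vle0 y).2 y0).
  by rewrite (is_D_origin qc y0 LD).
- exact: vanishes_Delta0.
have mp_fin y : orthant y -> (mp (boxoc 0 y) < +oo)%E by move=> /mE[].
have mm_fin y : orthant y -> (mm (boxoc 0 y) < +oo)%E by move=> /mE[].
have FE y : orthant y -> Ftrans q y = boxcdf mp y - boxcdf mm y.
  by move=> y0; rewrite Ftrans_Delta //; have [_ _ ->] := mE y y0.
have rcp := rcontinuous_boxcdf mp_fin; have rcm := rcontinuous_boxcdf mm_fin.
have gp : [/\ rcontinuous (boxcdf mp), Delta_monotone (boxcdf mp) & grounded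
  (boxcdf mp)].
  by split=> //; [exact: Delta_monotone_boxcdf|apply: vanishes_grounded => //;
    exact: boxcdf_vanishes].
have gm : [/\ rcontinuous (boxcdf mm), Delta_monotone (boxcdf mm) & grounded
  (boxcdf mm)].
  by split=> //; [exact: Delta_monotone_boxcdf|apply: vanishes_grounded => //;
    exact: boxcdf_vanishes].
have zero0 (m : {measure set T -> \bar R}) : boxcdf m 0 = 0.
  apply: boxcdf_vanishes; first exact: orthant0.
  by exists (Ordinal n0); rewrite mxE.
exists (boxcdf mp), (boxcdf mm); split=> //.
  by case: mfin => mfin; [left|right]; apply: bounded_boxcdf.
move=> y y0.
have Fc : rcontinuous (Ftrans q) := rcontinuous_eq FE (rcontinuousB rcp rcm).
have F0 : vanishes_on_axes (Ftrans q).
  by move=> x x0 xi; rewrite Ftrans_Delta // vanishes_Delta0.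
have VE : VarHK (Ftrans q) 0 y = (VarHK (boxcdf mp) 0 y + VarHK (boxcdf mm) 0
  y)%E.
  rewrite VarHK_grounded // (vitali_variation_jordan mP mpP mmP mp_fin mm_fin
    FE) //.
  by rewrite !VarHK_monotone.
split=> //; first exact: FE.
by rewrite VE !VarHK_monotone // -EFinD ltry.
Qed.

Lemma jordan_pair_Delta n (q g h : 'rV[R]_n -> R) x y : rcontinuous q ->
  jordan_pair q g h -> orthant x -> vle x y ->
  Delta x y q = Delta x y g - Delta x y h.
Proof.
move=> qc [_ _ _ qE] x0 xy; rewrite -Delta_Delta0 -DeltaB.
apply: eq_Delta => // z xz _.
have z0 : orthant z by apply/vle0; apply: vle_trans xz; apply/vle0.
by rewrite -Ftrans_Delta //; have [] := qE z z0.
Qed.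

(** [q'] is allowed besides [q] because, for the full index set, the transported [f] agrees with its
    marginal on the orthant only. *)
Lemma measure_inducing_jordan_pair n (q q' g h : 'rV[R]_n -> R) : (0 < n)%N ->
  rcontinuous q -> jordan_pair q g h -> (forall x, orthant x -> q' x = q x) ->
  measure_inducing q'.
Proof.
move=> n0 qc qgh q'q; have [[gP hP] b _ _] := qgh.
apply: (measure_inducing_difference n0 gP hP b) => x y x0 xy.
rewrite -(jordan_pair_Delta qc qgh) //; apply: eq_Delta => // z xz _.
by apply: q'q; apply/vle0; apply: vle_trans xz; apply/vle0.
Qed.

Variable d : nat.
Implicit Types (f : 'rV[R]_d -> R) (I : {set 'I_d}).

Lemma sum_Ftrans_marginal f x : rcontinuous f -> orthant x ->
  f x = f 0 + \sum_(I : {set 'I_d} | I != finset.set0)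
                Ftrans (marginal f I) (restr I x).
Proof.
move=> fc x0; rewrite {1}(sum_Delta_marginals f x) (bigD1 finset.set0) //=.
rewrite Delta_marginal0; congr (_ + _); apply: eq_bigr => I _.
have rx0 := orthant_restr (I := I) x0.
rewrite Ftrans_Delta //; last exact: rcontinuous_marginal.
apply: eq_Delta; first exact/vle0.
by move=> z z0 _; rewrite marginalE //; apply/vle0.
Qed.

Lemma decompositionP f (g h : forall I, 'rV[R]_#|I| -> R) : decomposition f g h
  ->
  forall I, I != finset.set0 -> jordan_pair (marginal f I) (g I) (h I).
Proof. by move=> [fgh _] I /fgh[_ ? ? ? ?]; split. Qed.

Lemma exists_decomposition f : Fmicl f -> rcontinuous f ->
  exists g h, decomposition f g h.
Proof.
move=> [_ fI] fc.
have ex I : exists gh : ('rV[R]_#|I| -> R) * ('rV[R]_#|I| -> R),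
    I != finset.set0 -> jordan_pair (marginal f I) gh.1 gh.2.
  (* The families are indexed by all subsets; the empty one receives a dummy pair. *)
  have [->|I0] := eqVneq I finset.set0; first by exists (fun=> 0, fun=> 0).
  have [_ [mi _ _ _]] := fI I I0.
  have n0 : (0 < #|I|)%N by rewrite card_gt0.
  have [g [h gh]] := exists_jordan_pair n0 (rcontinuous_marginal fc (I := I))
    mi.
  by exists (g, h).
pose gh I := projT1 (cid (ex I)).
have ghP I : I != finset.set0 -> jordan_pair (marginal f I) (gh I).1 (gh I).2.
  exact: (projT2 (cid (ex I))).
exists (fun I => (gh I).1), (fun I => (gh I).2); split.
  move=> I I0; have [? ? ? ?] := ghP I I0; split=> //; split.
    exact: has_marginal_rc.
  by apply: has_Ftrans_rc; exact: rcontinuous_marginal.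
move=> x x0; rewrite (sum_by_card (fun I => (gh I).1 (restr I x) - (gh I).2
  (restr I x))).
rewrite {1}(sum_Ftrans_marginal fc x0); congr (_ + _); apply: eq_bigr => I I0.
have [_ _ _ E] := ghP I I0.
by have [] := E _ (orthant_restr (I := I) x0).
Qed.

Lemma decomposition_Fmicl f (g h : forall I, 'rV[R]_#|I| -> R) :
  decomposition f g h -> Fmicl f /\ rcontinuous f.
Proof.
move=> fgh; have jp := decompositionP fgh; have [_ fE] := fgh.
have {}fE x : orthant x -> f x = f 0 + \sum_(I : {set 'I_d} | I != finset.set0)
    (g I (restr I x) - h I (restr I x)).
  by move=> /fE ->; rewrite (sum_by_card (fun I => g I (restr I x) - h I (restr
    I x))).
have fc : rcontinuous f.
  apply: (rcontinuous_eq fE) => x x0 i; apply: cvgD; first exact: cvg_cst.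
  apply: cvg_rsum => I I0; have [[[gc _ _] [hc _ _]] _ _ _] := jp I I0.
  exact: (rcontinuousB (rcontinuous_restr gc) (rcontinuous_restr hc)).
have fl : left_limits f.
  apply: (left_limits_eq fE); apply: left_limitsD; first exact: left_limits_cst.
  apply: left_limits_sum => I I0; have [[[_ gm _] [_ hm _]] _ _ _] := jp I I0.
  by apply: left_limitsB; apply: left_limits_restr; apply: left_limits_monotone.
have mI I : I != finset.set0 -> measure_inducing (marginal f I).
  move=> I0; apply: (measure_inducing_jordan_pair _ _ (jp I I0)) => //.
    by rewrite card_gt0.
  exact: rcontinuous_marginal.
split=> //; split.
  apply: Fmic_rcontinuous => //.
  have [d0|d0] := posnP d; first by move: f {fgh jp fE fc fl mI};
    rewrite d0 => f; exact: measure_inducing_dim0.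
  have T0 : [set: 'I_d]%SET != finset.set0 by rewrite -card_gt0 card_full.
  (* For d > 0 the pair of the full index set represents [f] itself, up to the transport from
     R^|{1,...,d}| to R^d. *)
  apply: (cast_transfer (e := card_full d) (P := fun n q => measure_inducing
    q)).
  apply: (measure_inducing_jordan_pair _ _ (jp _ T0)).
  - by rewrite card_full.
  - exact: rcontinuous_marginal.
  - by move=> x x0; rewrite marginalE // fill_full.
move=> I I0; split; first exact: has_marginal_rc.
apply: Fmic_rcontinuous; [exact: rcontinuous_marginal|exact:
  left_limits_marginal|exact: mI].
Qed.

End Characterization.

Theorem theoremA12 (R : realType) (d : nat) (f : 'rV[R]_d -> R) :
  ((Fmicl f /\ rcontinuous f) <->
   (exists g h : forall I : {set 'I_d}, 'rV[R]_#|I| -> R,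
      decomposition f g h)) /\
  (forall g h g' h' : forall I : {set 'I_d}, 'rV[R]_#|I| -> R,
     decomposition f g h -> decomposition f g' h' ->
     forall I : {set 'I_d}, I != finset.set0 ->
     forall y : 'rV[R]_#|I|, orthant y -> g I y = g' I y /\ h I y = h' I y).
Proof.
split.
  split=> [[]|[g [h]]]; [exact: exists_decomposition|exact:
    decomposition_Fmicl].
move=> g h g' h' fgh fgh' I I0 y y0.
have n0 : (0 < #|I|)%N by rewrite card_gt0.
by have := jordan_pair_unique n0 (decompositionP fgh I0) (decompositionP fgh'
  I0) y0.
Qed.
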